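(* Let $\omega$ be an odd symplectic form on the formal noncommutative supermanifold of a $\mathbb Z$-graded vector space $\mathcal H$ over $\mathbb C$. Then there is a coordinate transformation of the formal noncommutative supermanifold that transforms $\omega$ into a constant symplectic form.
   Context: Let $\{e_i\}$ be a homogeneous basis of the $\mathbb Z$-graded $\mathbb C$-vector space $\mathcal H$ and $\{\phi^i\}$ the dual coordinates, $\deg\phi^i=-\deg e_i$; write $i$ for $\deg e_i$ in exponents. The formal noncommutative supermanifold of $\mathcal H$ is described by the algebra $C(\phi)$ of formal power series in the associative noncommuting variables $\phi^i$. Differential forms: adjoin symbols $d\phi^i$, carrying the same degree as $\phi^i$ and an additional independent form degree $\sharp=1$ (while $\sharp(\phi^i)=0$). Write $\varphi^\mu$ for either $\phi^i$ or $d\phi^i$. $C(\varphi)_c$ is the space of formal series of terms $\frac1k a_{\mu_1\cdots\mu_k}\varphi^{\mu_k}\cdots\varphi^{\mu_1}$ $(k\ge1)$ whose coefficients are cyclic: $a_{\mu_1\cdots\mu_k}=(-1)^{i_1(i_2+\cdots+i_k)+\sharp_{\mu_1}(\sharp_{\mu_2}+\cdots+\sharp_{\mu_k})}a_{\mu_2\cdots\mu_k\mu_1}$. $C(\varphi)_c^{\langle l\rangle}$ is the part of form degree $l$. The exterior derivative $d$ is the derivation with $\phi^i\mapsto d\phi^i\mapsto0$: $$d\Big(\tfrac1k a_{\mu_1\cdots\mu_k}\varphi^{\mu_k}\cdots\varphi^{\mu_1}\Big)=\tfrac1k\sum_{i=1}^k(-1)^{\sharp_{\mu_1}+\cdots+\sharp_{\mu_{i-1}}}a_{\mu_1\cdots\mu_k}\varphi^{\mu_k}\cdots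 d\varphi^{\mu_i}\cdots\varphi^{\mu_1}.$$ An odd symplectic form is a closed $\omega\in C(\varphi)_c^{\langle2\rangle}$ of degree $-1$, $$\omega=\sum_{i,j,I,J}\omega_{ji,JI}(\phi^Id\phi^i\phi^Jd\phi^j)_c,\qquad \omega_{ij,IJ}=-\omega_{ji,JI},$$ where $I,J$ are multi-indices ($\phi^I$ denotes the corresponding monomial), $(\ )_c$ denotes graded cyclic symmetrization, and the constant part $(\omega_{ij,\emptyset\emptyset})$ is nondegenerate. It is constant if $\omega_{ij,IJ}=0$ unless $I=J=\emptyset$. A coordinate transformation is an invertible degree-preserving formal change of variables $\phi^i\mapsto f^i_j\phi^j+f^i_{j_1j_2}\phi^{j_2}\phi^{j_1}+\cdots$; it acts on cyclic functions by substitution followed by cyclic symmetrization and on forms compatibly with $d$. *)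

(* Defs.v *)
From HB Require Import structures.
From mathcomp Require Import all_boot all_order all_algebra.
From mathcomp Require Import complex.
From mathcomp Require Import boolp classical_sets functions cardinality fsbigop.
From mathcomp Require Import reals.

Set Implicit Arguments.
Unset Strict Implicit.
Unset Printing Implicit Defensive.

Import Order.TTheory GRing.Theory Num.Theory.
Local Open Scope classical_set_scope.
Local Open Scope ring_scope.

(* The Z-graded vector space H enters through a homogeneous basis (e_i),
   indexed by an arbitrary choiceType I, and the degrees deg i = deg e_i.

   The word phi^{mu_k} ... phi^{mu_1} is encoded by [:: mu_1; ...; mu_k], the
   order in which its coefficient a_{mu_1 ... mu_k} lists the indices. *)

Section FormalSeries.
Variable K : fieldType.

Definition series (A : Type) := seq A -> K.

Definition mono (A : eqType) (u : seq A) : series A := fun nu => (nu == u)%:R.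

(* Because of the encoding, [mulser s t] is the product t s of the paper's
   conventions. *)
Definition mulser (A : Type) (s t : series A) : series A :=
  fun nu => \sum_(p < (size nu).+1) s (take p nu) * t (drop p nu).

Definition monosubst (A : Type) (B : eqType) (f : A -> series B) (mu : seq A) :
  series B := foldr (fun x => mulser (f x)) (mono [::]) mu.

(* The sum is finitely supported for each nu when no f x has a constant term
   and each word occurs in only finitely many of the series f x. *)
Definition subst (A : choiceType) (B : eqType) (f : A -> series B)
    (b : series A) : series B :=
  fun nu => \sum_(mu \in [set: seq A]) b mu * monosubst f mu nu.

End FormalSeries.

Section NCSupermanifold.
Variables (K : fieldType) (I : choiceType) (deg : I -> int).

(* (i, false) is phi^i and (i, true) is d phi^i; the boolean is the form
   degree. *)
Definition letter := (I * bool)%type.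

Definition wdeg (J : seq I) : int := \sum_(j <- J) - deg j.

Definition ldeg (u : seq letter) : int := wdeg (map fst u).

Definition sharp (u : seq letter) : nat := count snd u.

(* Sign produced by exchanging the words u and v: the degree and the form
   degree contribute independently. *)
Definition swap_sign (u v : seq letter) : K :=
  (-1) ^ (ldeg u * ldeg v) * (-1) ^+ (sharp u * sharp v).

(* An element of C(varphi)_c is given by its coefficients a_{mu_1 ... mu_k};
   the factor 1/k of the corresponding formal series is left implicit. *)
Definition cyclic_form (a : series K letter) : Prop :=
  a [::] = 0 /\
  forall x u, a (x :: u) = swap_sign [:: x] u * a (rcons u x).

Definition has_form_degree (l : nat) (a : series K letter) : Prop :=
  forall u, a u != 0 -> sharp u = l.

Definition has_degree (n : int) (a : series K letter) : Prop :=
  forall u, a u != 0 -> ldeg u = n.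

(* Graded cyclic symmetrization (averaging over rotations) of the series with
   coefficients c.  The result a is in the normalization (1/k) a_{mu_1...mu_k},
   so the 1/k of the average is absorbed. *)
Definition csym (c : series K letter) : series K letter :=
  fun nu => \sum_(r < size nu)
    swap_sign (take r nu) (drop r nu) * c (rot r nu).

(* Coefficient of the word nu in d a, collecting the words that d maps to
   nu.  As d preserves the length, the formula is the same with or without the
   factors 1/k. *)
Definition dser (a : series K letter) : series K letter :=
  fun nu => \sum_(p < size nu)
    let x := tnth (in_tuple nu) p in
    if x.2 then
      (-1) ^+ sharp (take p nu) * a (take p nu ++ (x.1, false) :: drop p.+1 nu)
    else 0.

Definition closed_form (a : series K letter) : Prop := forall nu, dser a nu = 0.

(* F i [:: j_1; ...; j_k] = f^i_{j_1 ... j_k}.  As f is a family of maps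
   H^{(x) k} -> H, each multi-index carries finitely many nonzero f^i_J, a
   condition that is void when H is finite-dimensional. *)
Definition formal_map (F : I -> series K I) : Prop :=
  [/\ forall i, F i [::] = 0,
      forall J, finite_set [set i | F i J != 0]
    & forall i J, F i J != 0 -> wdeg J = - deg i].

Definition coordinate_transformation (F : I -> series K I) : Prop :=
  formal_map F /\
  exists G : I -> series K I,
    [/\ formal_map G,
        forall i, subst G (F i) =1 mono K [:: i]
      & forall i, subst F (G i) =1 mono K [:: i]].

Definition fun_series (s : series K I) : series K letter :=
  fun nu => if sharp nu == 0%N then s (map fst nu) else 0.

(* phi^i |-> F^i and d phi^i |-> d F^i *)
Definition form_image (F : I -> series K I) (x : letter) : series K letter :=
  if x.2 then dser (fun_series (F x.1)) else fun_series (F x.1).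

Definition transform (F : I -> series K I) (a : series K letter) :
    series K letter :=
  csym (subst (form_image F) (fun mu => a mu / (size mu)%:R)).

(* The coefficient omega_{ji,JI} is [om j i J I]. *)
Definition two_coefs := I -> I -> seq I -> seq I -> K.

Definition phis (J : seq I) : seq letter := [seq (j, false) | j <- J].

(* phi^I d phi^i phi^J d phi^j *)
Definition two_word (j i : I) (J L : seq I) : seq letter :=
  (j, true) :: phis J ++ (i, true) :: phis L.

(* sum of the omega_{ji,JI} (phi^I d phi^i phi^J d phi^j)_c *)
Definition two_form (om : two_coefs) : series K letter :=
  fun nu => \sum_(t \in [set: (I * I) * (seq I * seq I)])
    om t.1.1 t.1.2 t.2.1 t.2.2 *
    csym (mono K (two_word t.1.1 t.1.2 t.2.1 t.2.2)) nu.

(* g identifies H with its graded dual: every linear functional c supported in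
   one degree is g(v, -) for a unique v in H.  For finite-dimensional H this is
   invertibility of the matrix g. *)
Definition nondegenerate_pairing (g : I -> I -> K) : Prop :=
  forall (n : int) (c : I -> K), (forall j, c j != 0 -> deg j = n) ->
  exists! v : I -> K,
    finite_set [set i | v i != 0] /\
    forall j, \sum_(i \in [set: I]) v i * g i j = c j.

(* The degree of omega is imposed on the coefficients as well: when the degrees
   of phi^I d phi^i and phi^J d phi^j are both odd, the (ji,JI) and (ij,IJ)
   terms cancel, and omega does not determine omega_{ji,JI}. *)
Definition symplectic_coefs (om : two_coefs) (w : series K letter) : Prop :=
  [/\ w =1 two_form om,
      forall i j J L, om i j J L = - om j i L J,
      forall i j J L, om i j J L != 0 -> ldeg (two_word i j J L) = -1
    & nondegenerate_pairing (fun i j => om i j [::] [::])].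

Definition odd_two_form (w : series K letter) : Prop :=
  [/\ cyclic_form w, has_form_degree 2 w, has_degree (-1) w & closed_form w].

Definition odd_symplectic (w : series K letter) : Prop :=
  odd_two_form w /\ exists om, symplectic_coefs om w.

Definition constant_coefs (om : two_coefs) : Prop :=
  forall i j J L, (J, L) <> ([::], [::]) -> om i j J L = 0.

Definition constant_odd_symplectic (w : series K letter) : Prop :=
  odd_two_form w /\
  exists om, symplectic_coefs om w /\ constant_coefs om.

End NCSupermanifold.

(* Main.v *)
Require Import Defs.
From mathcomp Require Import all_boot all_order all_algebra.
From mathcomp Require Import complex reals.
From mathcomp Require Import boolp classical_sets cardinality fsbigop.
From mathcomp Require Import ring zify.

Set Implicit Arguments.
Unset Strict Implicit.
Unset Printing Implicit Defensive.

Import Order.TTheory GRing.Theory Num.Theory.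
Local Open Scope classical_set_scope.
Local Open Scope ring_scope.

(** The coordinate transformation is built order by order, and every equation to
    be solved is linear.  Let w' be the transform of w by a formal map F which is
    the identity in first order, and suppose that w' vanishes on the words of
    lengths 3 to n.  Adding to F a correction P that starts in order n leaves the
    transform alone up to length n.  In length n+1 only the quadratic part of
    w sees P.  Its coefficients are 2 g_ij, where g is the nondegenerate constant
    part, and the transform changes by the cyclic symmetrization of
    sum_j dQ_j dphi^j, where Q_j = sum_i 2 g_ij P^i ([subst_variation]).

    Transformation commutes with d ([dser_subst]), so w' is again a closed cyclic
    2-form ([odd_two_form_transform]).  By the Poincare lemma it is the derivative
    of a cyclic 1-form theta ([dser_primitive]).  A cyclic 1-form is the cyclic
    symmetrization of its part theta_j dphi^j on the words that end with a
    differential, so that w' is the symmetrization of sum_j dtheta_j dphi^j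
    ([csym_dser_primitive_tail]).  Hence P cancels length n+1 as soon as
    sum_i 2 g_ij P^i = - theta_j, and nondegeneracy of g solves this word by word
    with finitely many P^i of the right degree ([solver_exists]).  Since a step
    does not touch the orders below n, the iterates stabilize on each word, and
    their limit turns w into its quadratic part ([darboux_map],
    [two_form_constant]).

    A formal map that is the identity in first order has a left inverse, again by
    recursion on the order, and this left inverse has one in turn, so the map is
    invertible ([unipotent_coordinate_transformation]).

    The basis of H is arbitrary, so that sums over indices are finite only one
    coefficient at a time.  What keeps this under control is that all operators
    involved are row-finite: each coefficient of the result is a fixed finite
    linear combination of coefficients of the argument.  Two such operators agree
    if they agree on monomials ([row_finite_ext]), which reduces the algebraic
    identities about series to identities about words. *)

(** * Row-finite operators on formal series *)

Section RowFinite.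
Variable K : fieldType.

Lemma fsum_seq (T : choiceType) (r : seq T) (f : T -> K) :
    uniq r -> (forall x, f x != 0 -> x \in r) ->
  \sum_(x \in [set: T]) f x = \sum_(x <- r) f x.
Proof.
move=> ur fr; rewrite (fsbigE r) //= => [|x _ xr].
  by apply: eq_bigl => x; rewrite in_setT.
by apply/eqP; apply: contraNT xr => /fr.
Qed.

Lemma finite_support_seq (T : choiceType) (f : T -> K) :
    finite_set [set x | f x != 0] ->
  exists2 r : seq T, uniq r & forall x, f x != 0 -> x \in r.
Proof.
move=> /finite_seqP[s fs]; exists (undup s); first exact: undup_uniq.
move=> x fx; rewrite mem_undup.
by have : [set x | f x != 0] x by []; rewrite fs.
Qed.

Definition finite_functional (A : Type) (L : series K A -> K) :=
  exists s : seq (K * seq A), forall a, L a = \sum_(x <- s) x.1 * a x.2.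

Definition row_finite (A B : Type) (Phi : series K A -> series K B) :=
  forall nu, finite_functional (fun a => Phi a nu).

Section Closure.
Variable A : eqType.
Implicit Type L M : series K A -> K.

Lemma finite_functional_eval u : finite_functional (fun a : series K A => a u).
Proof. by exists [:: (1, u)] => a; rewrite big_seq1 mul1r. Qed.

Lemma finite_functional0 : finite_functional (fun _ : series K A => 0).
Proof. by exists [::] => a; rewrite big_nil. Qed.

Lemma finite_functionalD L M :
  finite_functional L -> finite_functional M ->
  finite_functional (fun a => L a + M a).
Proof.
move=> [s Ls] [t Mt]; exists (s ++ t) => a.
by rewrite big_cat /= Ls Mt.
Qed.

Lemma finite_functionalZ c L :
  finite_functional L -> finite_functional (fun a => c * L a).
Proof.
move=> [s Ls]; exists [seq (c * x.1, x.2) | x <- s] => a.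
by rewrite big_map Ls mulr_sumr; apply: eq_bigr => x _; rewrite mulrA.
Qed.

Lemma finite_functional_sum T (r : seq T) (F : T -> series K A -> K) :
  (forall i, finite_functional (F i)) ->
  finite_functional (fun a => \sum_(i <- r) F i a).
Proof.
move=> Ff; elim: r => [|i r [s IH]].
  by exists [::] => a; rewrite !big_nil.
have [t Ft] := Ff i; exists (t ++ s) => a.
by rewrite big_cons big_cat /= Ft IH.
Qed.

Lemma finite_functional_comp (B : eqType) (L : series K B -> K)
    (Phi : series K A -> series K B) :
  finite_functional L -> row_finite Phi ->
  finite_functional (fun a => L (Phi a)).
Proof.
move=> [s Ls] Pf.
suff [t Ht] : finite_functional (fun a => \sum_(x <- s) x.1 * Phi a x.2).
  by exists t => a; rewrite Ls Ht.
by apply: finite_functional_sum => x; apply: finite_functionalZ; apply: Pf.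
Qed.

Lemma finite_functional_lin L c a b : finite_functional L ->
  L (fun nu => c * a nu + b nu) = c * L a + L b.
Proof.
move=> [s Ls]; rewrite !Ls mulr_sumr -big_split /=.
by apply: eq_bigr => x _; rewrite mulrDr mulrCA.
Qed.

(** The families summed over are only locally finite; the finitely many words
    read by L leave finitely many relevant indices. *)
Lemma finite_functional_fsum (T : choiceType) L (G : T -> series K A) :
    finite_functional L ->
    (forall nu, finite_set [set i | G i nu != 0]) ->
  L (fun nu => \sum_(i \in [set: T]) G i nu) = \sum_(i \in [set: T]) L (G i).
Proof.
move=> [s Ls] Gf.
have [r ur Gr] : exists2 r : seq T, uniq r &
    forall i x, x \in map snd s -> G i x != 0 -> i \in r.
  elim: (map snd s) => [|u l [r ur Gr]]; first by exists [::].
  have [t ut Gt] := finite_support_seq (Gf u).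
  exists (undup (r ++ t)) => [|i x]; first exact: undup_uniq.
  rewrite mem_undup mem_cat inE => /predU1P[->|xl] Gx.
    by rewrite (Gt _ Gx) orbT.
  by rewrite (Gr _ _ xl Gx).
rewrite (fsum_seq ur) => [|i]; last first.
  rewrite Ls; apply: contra_neqT => ir; rewrite big_seq big1// => x xs.
  rewrite [G i _](_ : _ = 0) ?mulr0//; apply/eqP; apply: contraNT ir.
  by apply: Gr; apply: (map_f snd).
rewrite Ls; under [RHS]eq_bigr do rewrite Ls.
rewrite exchange_big /= big_seq [RHS]big_seq; apply: eq_bigr => x xs.
rewrite -mulr_sumr; congr (_ * _); apply: fsum_seq => // i; apply: Gr.
exact: (map_f snd).
Qed.

End Closure.

Lemma row_finite_comp (A B C : eqType) (Phi : series K B -> series K C)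
    (Psi : series K A -> series K B) :
  row_finite Phi -> row_finite Psi -> row_finite (fun a => Phi (Psi a)).
Proof. by move=> Pf Qf nu; exact: (finite_functional_comp (Pf nu) Qf). Qed.

(** A finite functional is determined by its values on the monomials of the
    finitely many words that it reads, because the argument can be replaced by
    its truncation to these words. *)
Lemma finite_functional_ext (A : eqType) (L M : series K A -> K) :
    finite_functional L -> finite_functional M ->
    (forall u, L (mono K u) = M (mono K u)) ->
  forall a, L a = M a.
Proof.
move=> [s Ls] [t Mt] eqLM a.
pose r := undup (map snd (s ++ t)).
have expand (l : seq (K * seq A)) : {subset map snd l <= r} ->
    \sum_(x <- l) x.1 * a x.2 =
    \sum_(u <- r) (\sum_(x <- l) x.1 * mono K u x.2) * a u.
  move=> lr; under [RHS]eq_bigr do rewrite mulr_suml.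
  rewrite exchange_big /= big_seq [RHS]big_seq; apply: eq_bigr => x xl.
  have xr : x.2 \in r by apply/lr/(map_f snd).
  rewrite (bigD1_seq x.2) ?undup_uniq//=.
  rewrite /mono eqxx mulr1 big1 ?addr0// => u /negPf ux.
  by rewrite eq_sym ux mulr0 mul0r.
rewrite Ls Mt !expand; first by apply: eq_bigr => u _; rewrite -Ls -Mt eqLM.
all: by move=> u us; rewrite mem_undup map_cat mem_cat us ?orbT.
Qed.

Lemma row_finite_ext (A : eqType) (B : Type)
    (Phi Psi : series K A -> series K B) :
    row_finite Phi -> row_finite Psi ->
    (forall u, Phi (mono K u) = Psi (mono K u)) ->
  forall a, Phi a = Psi a.
Proof.
move=> Pf Qf eqPQ a; apply: funext => nu.
by apply: (finite_functional_ext (Pf nu) (Qf nu)) => u; rewrite eqPQ.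
Qed.

Lemma row_finite_lin (A B : eqType) (Phi : series K A -> series K B) c a b nu :
  row_finite Phi ->
  Phi (fun u => c * a u + b u) nu = c * Phi a nu + Phi b nu.
Proof. by move=> Pf; rewrite (finite_functional_lin c a b (Pf nu)). Qed.

Lemma row_finite0 (A B : eqType) (Phi : series K A -> series K B) nu :
  row_finite Phi -> Phi (fun=> 0) nu = 0.
Proof.
by move=> /(_ nu)[s ->]; rewrite big1// => x _; rewrite mulr0.
Qed.

End RowFinite.

(** * Products and substitution *)

Section Substitution.
Variable K : fieldType.

Lemma mono_neq0 (A : eqType) (u v : seq A) : mono K u v != 0 -> v = u.
Proof. by rewrite /mono; case: (v =P u) => // _; rewrite mulr0n eqxx. Qed.

Lemma mulser_nil (A : Type) (s t : series K A) :
  mulser s t [::] = s [::] * t [::].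
Proof. by rewrite /mulser big_ord_recl big_ord0 addr0. Qed.

Lemma mulser_cons (A : Type) (s t : series K A) x u :
  mulser s t (x :: u) =
    s [::] * t (x :: u) + mulser (fun v => s (x :: v)) t u.
Proof. by rewrite /mulser big_ord_recl. Qed.

Lemma row_finite_mulserl (A : eqType) (t : series K A) :
  row_finite (fun s => mulser s t).
Proof.
move=> nu; apply: finite_functional_sum => p.
have [r Hr] := finite_functionalZ (t (drop p nu))
  (finite_functional_eval K (take p nu)).
by exists r => a; rewrite mulrC Hr.
Qed.

Lemma row_finite_mulserr (A : eqType) (s : series K A) :
  row_finite (mulser s).
Proof.
move=> nu; apply: finite_functional_sum => p.
by apply: finite_functionalZ; apply: finite_functional_eval.
Qed.

Lemma mulser0l (A : Type) (t : series K A) nu : mulser (fun=> 0) t nu = 0.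
Proof. by rewrite /mulser big1// => p _; rewrite mul0r. Qed.

Lemma mulser_neq0 (A : Type) (s t : series K A) nu : mulser s t nu != 0 ->
  exists2 p, (p <= size nu)%N & s (take p nu) != 0 /\ t (drop p nu) != 0.
Proof.
move=> nz; suff [p] : exists p : 'I_(size nu).+1,
    s (take p nu) * t (drop p nu) != 0.
  by rewrite mulf_eq0 negb_or => /andP[? ?]; exists p; rewrite // -ltnS.
apply: contrapT => /forallNP all0; move: nz.
rewrite /mulser big1 ?eqxx// => p _.
by apply/eqP/negPn/negP/all0.
Qed.

Lemma mulser_monol (A : eqType) (t : series K A) (u : seq A) nu :
  mulser (mono K u) t nu = if prefix u nu then t (drop (size u) nu) else 0.
Proof.
elim: u nu => [|x u IH] [|y nu].
- by rewrite mulser_nil mul1r.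
- by rewrite mulser_cons mul1r (mulser0l t nu) addr0.
- by rewrite mulser_nil mul0r.
rewrite mulser_cons mul0r add0r /= eq_sym; case: eqP => [->|/eqP yx] /=.
  rewrite -IH; congr (mulser _ _ _); apply: funext => v.
  by rewrite /mono eqseq_cons eqxx.
rewrite [X in mulser X](_ : _ = fun=> 0) ?mulser0l//.
by apply: funext => v; rewrite /mono eqseq_cons (negPf yx).
Qed.

Lemma mulser1l (A : eqType) (t : series K A) : mulser (mono K [::]) t = t.
Proof. by apply: funext => nu; rewrite mulser_monol prefix0s drop0. Qed.

Lemma mulser_mono (A : eqType) (u v : seq A) :
  mulser (mono K u) (mono K v) = mono K (u ++ v).
Proof.
apply: funext => nu; rewrite mulser_monol /mono.
case: (boolP (prefix u nu)) => [/prefixP[w ->]|nu_u].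
  by rewrite drop_size_cat// eqseq_cat// eqxx.
by case: eqP => // nuE; rewrite nuE prefix_prefix in nu_u.
Qed.

Lemma mulser1r (A : eqType) (s : series K A) : mulser s (mono K [::]) = s.
Proof.
apply: (row_finite_ext (Psi := id) (row_finite_mulserl _)) => [nu|u].
  exact: finite_functional_eval.
by rewrite mulser_mono cats0.
Qed.

Lemma mulserA (A : eqType) (s t r : series K A) :
  mulser s (mulser t r) = mulser (mulser s t) r.
Proof.
have lin_l := @row_finite_mulserl A; have lin_r := @row_finite_mulserr A.
move: s; apply: row_finite_ext => [|| u]; first exact: lin_l.
  exact: (row_finite_comp (lin_l r) (lin_l t)).
move: t; apply: row_finite_ext => [|| v].
- exact: (row_finite_comp (lin_r _) (lin_l r)).
- exact: (row_finite_comp (lin_l r) (lin_r _)).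
move: r; apply: row_finite_ext => [|| w]; last by rewrite !mulser_mono catA.
  exact: (row_finite_comp (lin_r _) (lin_r _)).
exact: lin_r.
Qed.

Lemma monosubst_cat (A : Type) (B : eqType) (f : A -> series K B) u v :
  monosubst f (u ++ v) = mulser (monosubst f u) (monosubst f v).
Proof.
elim: u => [|x u IH] /=; first by rewrite mulser1l.
by rewrite IH mulserA.
Qed.

(** The condition under which substitution is well defined: without constant
    terms a word can only be cut into finitely many non-empty pieces, and each
    piece comes from finitely many letters. *)
Definition locally_finite (A B : Type) (f : A -> series K B) :=
  (forall x, f x [::] = 0) /\ forall nu, finite_set [set x | f x nu != 0].

Lemma monosubst_size (A : Type) (B : eqType) (f : A -> series K B) mu nu :
    (forall x, f x [::] = 0) ->
  monosubst f mu nu != 0 -> (size mu <= size nu)%N.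
Proof.
move=> f0; elim: mu nu => [|x mu IH] nu //= /mulser_neq0[[|p] ple []].
  by rewrite take0 f0 eqxx.
move=> _ /IH; rewrite size_drop; lia.
Qed.

Lemma monosubst_finite (A : Type) (B : eqType) (f : A -> series K B) nu :
  locally_finite f -> finite_set [set mu | monosubst f mu nu != 0].
Proof.
move=> [f0 ffin]; have [n] := ubnP (size nu).
elim: n nu => // n IH nu /ltnSE le_nu.
apply: (@sub_finite_set _ _ ([set [::]] `|` \bigcup_(p in `I_(size nu).+1)
    [set x :: mu | x in [set x | f x (take p nu) != 0] &
      mu in [set mu | (0 < p)%N /\ monosubst f mu (drop p nu) != 0]])).
  case=> [|x mu] /=; first by left.
  move=> /mulser_neq0[p ple [fx fmu]]; right; exists p => //=.
  exists x => //; exists mu => //; split=> //; case: p fx {ple fmu} => //.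
  by rewrite take0 f0 eqxx.
rewrite finite_setU; split=> //; apply: bigcup_finite => // p /=.
move=> ple; apply: finite_image2 => //.
case: p ple => [|p] ple.
  by rewrite (_ : (mkset _) = set0) // -subset0 => ? [].
apply: sub_finite_set (IH (drop p.+1 nu) _); first by move=> ? [].
rewrite size_drop; lia.
Qed.

Lemma monosubst_seq (A : choiceType) (B : eqType) (f : A -> series K B) nu :
  locally_finite f -> exists r : seq (seq A),
    uniq r /\ forall b, subst f b nu = \sum_(mu <- r) b mu * monosubst f mu nu.
Proof.
move=> flf; have [r ur fr] := finite_support_seq (monosubst_finite nu flf).
exists r; split=> // b; apply: fsum_seq => // mu.
by rewrite mulf_eq0 negb_or => /andP[_ /fr].
Qed.

Lemma row_finite_subst (A : choiceType) (B : eqType) (f : A -> series K B) :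
  locally_finite f -> row_finite (subst f).
Proof.
move=> flf nu; have [r [_ Hr]] := monosubst_seq nu flf.
exists [seq (monosubst f mu nu, mu) | mu <- r] => b.
by rewrite Hr big_map; apply: eq_bigr => mu _; rewrite mulrC.
Qed.

Lemma subst_mono (A : choiceType) (B : eqType) (f : A -> series K B) mu :
  subst f (mono K mu) = monosubst f mu.
Proof.
apply: funext => nu; rewrite /subst (@fsum_seq _ _ [:: mu])//.
  by rewrite big_seq1 /mono eqxx mul1r.
by move=> u; rewrite mulf_eq0 negb_or inE => /andP[/mono_neq0 -> _].
Qed.

(** By row-finiteness in each factor it is enough to multiply monomials, where
    the product is concatenation. *)
Lemma subst_mulser (A : choiceType) (B : eqType) (f : A -> series K B) s t :
  locally_finite f -> subst f (mulser s t) = mulser (subst f s) (subst f t).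
Proof.
move=> flf; have sf := row_finite_subst flf.
move: s; apply: row_finite_ext => [||u].
- exact: (row_finite_comp sf (row_finite_mulserl t)).
- exact: (row_finite_comp (row_finite_mulserl _) sf).
move: t; apply: row_finite_ext => [||v].
- exact: (row_finite_comp sf (row_finite_mulserr _)).
- exact: (row_finite_comp (row_finite_mulserr _) sf).
by rewrite mulser_mono !subst_mono monosubst_cat.
Qed.

Lemma subst_monosubst (A : Type) (B : choiceType) (C : eqType)
    (f : B -> series K C) (g : A -> series K B) mu :
  locally_finite f ->
  subst f (monosubst g mu) = monosubst (fun x => subst f (g x)) mu.
Proof.
move=> flf; elim: mu => [|x mu IH] /=; first by rewrite subst_mono.
by rewrite subst_mulser// IH.
Qed.

Lemma locally_finite_subst (A : Type) (B : choiceType) (C : eqType)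
    (f : B -> series K C) (g : A -> series K B) :
  locally_finite f -> locally_finite g ->
  locally_finite (fun x => subst f (g x)).
Proof.
move=> flf [g0 gfin]; split=> [x|nu].
  have [r [_ ->]] := monosubst_seq [::] flf; rewrite big1// => -[|y mu] _.
    by rewrite g0 mul0r.
  have [-> |] := eqVneq (monosubst f (y :: mu) [::]) 0; first by rewrite mulr0.
  by move/(monosubst_size flf.1).
have [r [_ Hr]] := monosubst_seq nu flf.
apply: (@sub_finite_set _ _ (\bigcup_(mu in [set` r]) [set x | g x mu != 0])).
  move=> x /=; rewrite Hr => nz; apply: contrapT => /forall2NP all0.
  move: nz; rewrite big_seq big1 ?eqxx// => mu mur.
  by case: (all0 mu) => // /negP/negPn/eqP ->; rewrite mul0r.
by apply: bigcup_finite.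
Qed.

Lemma subst_subst (A B : choiceType) (C : eqType)
    (f : B -> series K C) (g : A -> series K B) a :
  locally_finite f -> locally_finite g ->
  subst f (subst g a) = subst (fun x => subst f (g x)) a.
Proof.
move=> flf glf; move: a; apply: row_finite_ext => [||u].
- exact: (row_finite_comp (row_finite_subst flf) (row_finite_subst glf)).
- exact: row_finite_subst (locally_finite_subst flf glf).
by rewrite !subst_mono subst_monosubst.
Qed.

Lemma monosubst_id (A : eqType) (mu : seq A) :
  monosubst (fun x => mono K [:: x]) mu = mono K mu.
Proof. by elim: mu => //= x mu ->; rewrite mulser_mono. Qed.

Lemma locally_finite_id (A : eqType) :
  locally_finite (fun x : A => mono K [:: x]).
Proof.
split=> // nu; apply: (@sub_finite_set _ _ [set` nu]) => // x /=.
by move=> /mono_neq0 ->; rewrite inE.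
Qed.

Lemma subst_id (A : choiceType) (a : series K A) :
  subst (fun x => mono K [:: x]) a = a.
Proof.
move: a; apply: row_finite_ext => [|nu|u].
- exact/row_finite_subst/locally_finite_id.
- exact: finite_functional_eval.
by rewrite subst_mono monosubst_id.
Qed.

Lemma subst_letter (A : choiceType) (B : eqType) (f : A -> series K B) x :
  subst f (mono K [:: x]) = f x.
Proof. by rewrite subst_mono /= mulser1r. Qed.

(** A word of length at least 1 is substituted for every letter of mu, so none of
    them can be longer than the total length minus the number of the other
    letters. *)
Lemma eq_monosubst (A : Type) (B : eqType) (f g : A -> series K B) m mu nu :
    (forall x, f x [::] = 0) -> (forall x, g x [::] = 0) ->
    (forall x u, (size u <= m)%N -> f x u = g x u) ->
    (size nu < m + size mu)%N ->
  monosubst f mu nu = monosubst g mu nu.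
Proof.
move=> f0 g0 fg; elim: mu nu => [|x mu IH] nu //= lt_nu.
apply: eq_bigr => -[[|p] /= ple] _; first by rewrite take0 f0 g0 !mul0r.
rewrite IH; last by rewrite size_drop; lia.
have [pm|mp] := leqP p.+1 m.
  by rewrite fg// size_take; case: ltnP => //; lia.
have [-> |] := eqVneq (monosubst g mu (drop p.+1 nu)) 0.
  by rewrite !mulr0.
by move/(monosubst_size g0); rewrite size_drop; lia.
Qed.

Lemma eq_subst (A : choiceType) (B : eqType) (f g : A -> series K B)
    b m k nu :
    (forall x, f x [::] = 0) -> (forall x, g x [::] = 0) ->
    (forall x u, (size u <= m)%N -> f x u = g x u) ->
    (forall mu, b mu != 0 -> (k <= size mu)%N) ->
    (size nu < m + k)%N ->
  subst f b nu = subst g b nu.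
Proof.
move=> f0 g0 fg bk lt_nu; apply: eq_fsbigr => mu _.
have [->|/bk kmu] := eqVneq (b mu) 0; first by rewrite !mul0r.
by congr (_ * _); apply: eq_monosubst fg _ => //; lia.
Qed.

End Substitution.

(** * Exterior derivative, contraction and cyclic rotation *)

Section FormCalculus.
Variables (K : fieldType) (I : choiceType) (deg : I -> int).
Implicit Types (a s t : series K (letter I)) (u v nu : seq (letter I)).
Implicit Type x : letter I.

Local Notation swap := (swap_sign K deg).

Lemma wdeg_cons (i : I) J : wdeg deg (i :: J) = - deg i + wdeg deg J.
Proof. by rewrite /wdeg big_cons. Qed.

Lemma wdeg_cat (J L : seq I) : wdeg deg (J ++ L) = wdeg deg J + wdeg deg L.
Proof. by rewrite /wdeg big_cat. Qed.

Lemma ldeg_cat u v : ldeg deg (u ++ v) = ldeg deg u + ldeg deg v.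
Proof. by rewrite /ldeg map_cat wdeg_cat. Qed.

Lemma ldeg_rot r u : ldeg deg (rot r u) = ldeg deg u.
Proof. by rewrite /rot ldeg_cat addrC -ldeg_cat cat_take_drop. Qed.

Lemma sharp_cat u v : sharp (u ++ v) = (sharp u + sharp v)%N.
Proof. exact: count_cat. Qed.

Lemma sharp_rot r u : sharp (rot r u) = sharp u.
Proof. by rewrite /rot sharp_cat addnC -sharp_cat cat_take_drop. Qed.

Lemma swap_signC u v : swap u v = swap v u.
Proof. by rewrite /swap_sign [ldeg deg u * _]mulrC [(sharp u * _)%N]mulnC. Qed.

Lemma swap_sign_cat u v nu : swap (u ++ v) nu = swap u nu * swap v nu.
Proof.
rewrite /swap_sign ldeg_cat sharp_cat mulrDl mulnDl exprD.
by rewrite expfzDr ?oppr_eq0 ?oner_eq0// mulrACA.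
Qed.

Lemma swap_sign0 u : swap u [::] = 1.
Proof.
by rewrite /swap_sign /ldeg /wdeg /sharp /= big_nil mulr0 muln0 mulr1.
Qed.

Lemma swap_signK u v : swap u v * swap u v = 1.
Proof.
rewrite /swap_sign mulrACA -expfzDr ?oppr_eq0 ?oner_eq0// -exprD addnn.
rewrite -mul2n exprM sqrrN expr1n expr1n mulr1.
have -> z : (-1 : K) ^ (z + z) = 1; last by [].
by rewrite expfzDr ?oppr_eq0 ?oner_eq0// -expfzMl mulrNN mulr1 exp1rz.
Qed.

(** [switch true] is the exterior derivative, and [switch false] is the
    contraction with the Euler vector field, the derivation of form degree -1
    with dphi^i |-> phi^i |-> 0.  The recursion on the word makes the identities
    below provable by induction on the word, for both derivations at once. *)
Fixpoint switch (b : bool) (a : series K (letter I)) nu : K :=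
  if nu is x :: u then
    (if x.2 == b then a ((x.1, ~~ b) :: u) else 0) +
    (-1) ^+ x.2 * switch b (fun v => a (x :: v)) u
  else 0.

Lemma dserE a : dser a = switch true a.
Proof.
apply: funext => nu; elim: nu a => [|x u IH] a.
  by rewrite /dser big_ord0.
rewrite /dser big_ord_recl /= eqb_id (tnth_nth x) /= mul1r drop0 -IH.
congr (_ + _); rewrite /dser mulr_sumr; apply: eq_bigr => p _.
rewrite !(tnth_nth x) /= (fun_if (fun z => _ * z)) mulr0.
by case: ifP => // _; rewrite mulrA exprD.
Qed.

Lemma row_finite_switch b : row_finite (switch b).
Proof.
move=> nu; suff H (Phi : series K (letter I) -> series K (letter I)) :
  row_finite Phi -> finite_functional (fun a => switch b (Phi a) nu).
  by apply: (H id) => v; apply: finite_functional_eval.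
elim: nu Phi => [|x u IH] Phi Pf /=; first exact: finite_functional0.
apply: finite_functionalD; last first.
  by apply: finite_functionalZ; apply: (IH (fun a v => Phi a (x :: v))) => v.
by case: (x.2 == b); [apply: Pf | apply: finite_functional0].
Qed.

Lemma switch_lin b c s t :
  switch b (fun u => c * s u + t u) =
  fun nu => c * switch b s nu + switch b t nu.
Proof.
apply: funext => nu.
by rewrite (row_finite_lin _ _ _ _ (row_finite_switch b)).
Qed.

Lemma switchZ b c s : switch b (fun u => c * s u) = fun nu => c * switch b s nu.
Proof.
apply: funext => nu.
have [r Hr] := row_finite_switch b nu.
by rewrite !Hr mulr_sumr; apply: eq_bigr => z _; rewrite mulrCA.
Qed.

Lemma switch_sum b n (F : 'I_n -> series K (letter I)) nu :
  switch b (fun u => \sum_(r < n) F r u) nu = \sum_(r < n) switch b (F r) nu.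
Proof.
have [s Hs] := row_finite_switch b nu.
rewrite Hs; under [RHS]eq_bigr do rewrite Hs.
by rewrite exchange_big; apply: eq_bigr => z _; rewrite mulr_sumr.
Qed.

(** A word contributes to a coefficient of [switch b] only if it has the same
    indices and the form degree that the derivation shifts to the given one. *)
Lemma eq_switch (b : bool) s t nu :
    (forall u, map fst u = map fst nu ->
       (sharp u + b = sharp nu + ~~ b)%N -> s u = t u) ->
  switch b s nu = switch b t nu.
Proof.
elim: nu s t => [|x u IH] s t st //=; congr (_ + _ * _).
  case: eqP => // xb; apply: st => //=.
  by rewrite /sharp /= xb; case: (b); rewrite /= ?addn0 ?add0n // addnC.
apply: IH => v vu sv; apply: st => /=; first by rewrite vu.
by move: sv; rewrite /sharp /= -!addnA => ->.
Qed.

Lemma switch_neq0 (b : bool) s nu : switch b s nu != 0 -> exists u,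
  [/\ map fst u = map fst nu, (sharp u + b = sharp nu + ~~ b)%N & s u != 0].
Proof.
move=> nz; apply: contrapT => /forallNP none; move: nz.
rewrite (@eq_switch _ _ (fun=> 0)) => [|u unu su].
  by rewrite (row_finite0 _ (row_finite_switch b)) eqxx.
by apply/eqP/negPn/negP => su0; apply: (none u).
Qed.

Lemma switch_rcons b a u x : switch b a (rcons u x) =
  switch b (fun v => a (rcons v x)) u +
  (-1) ^+ sharp u * (if x.2 == b then a (rcons u (x.1, ~~ b)) else 0).
Proof.
elim: u a => [|y u IH] a /=; first by rewrite mulr0 addr0 mul1r add0r.
by rewrite IH mulrDr addrA /sharp /= exprD mulrA.
Qed.

Lemma switch_cons b a x u : switch b a (x :: u) =
  (if x.2 == b then a ((x.1, ~~ b) :: u) else 0) +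
    (-1) ^+ x.2 * switch b (fun v => a (x :: v)) u.
Proof. by []. Qed.

Lemma switch_cons_fun b a x :
  (fun u => switch b a (x :: u)) =
  fun u => (-1) ^+ x.2 * switch b (fun v => a (x :: v)) u +
    (if x.2 == b then a ((x.1, ~~ b) :: u) else 0).
Proof. by apply: funext => u; rewrite switch_cons addrC. Qed.

Lemma switch0 b nu : switch b (fun=> 0) nu = 0.
Proof. exact: row_finite0 (row_finite_switch b). Qed.

Lemma dser_dser a nu : dser (dser a) nu = 0.
Proof.
rewrite !dserE; elim: nu a => [|[i b] u IH] a //.
rewrite switch_cons switch_cons_fun switch_lin IH mulr0 add0r /=.
case: b => /=; last by rewrite switch0 mulr0 addr0.
by rewrite expr1 mulN1r add0r mul1r subrr.
Qed.

(** The homotopy behind the Poincare lemma: the anticommutator of d and the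
    contraction is the derivation that fixes every letter, so it multiplies a
    word by its length. *)
Lemma switch_homotopy a nu : switch true (switch false a) nu +
  switch false (switch true a) nu = (size nu)%:R * a nu.
Proof.
elim: nu a => [|[i b] u IH] a; first by rewrite addr0 mul0r.
rewrite !(switch_cons, switch_cons_fun) !switch_lin /= -natr1 mulrDl mul1r.
rewrite -(IH (fun v => a ((i, b) :: v))).
case: b => /=; rewrite ?switch0 expr1 ?expr0; ring.
Qed.

Lemma switch_mulser b s t :
  switch b (mulser s t) = fun nu =>
    mulser (switch b s) t nu +
    mulser (fun u => (-1) ^+ sharp u * s u) (switch b t) nu.
Proof.
apply: funext => nu; elim: nu s t => [|x u IH] s t.
  by rewrite !mulser_nil mul0r mulr0 addr0.
rewrite switch_cons !mulser_cons mul0r add0r.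
rewrite (_ : (fun v => mulser s t (x :: v)) = fun v => s [::] * t (x :: v) +
  mulser (fun w => s (x :: w)) t v); last first.
  by apply: funext => v; rewrite mulser_cons.
rewrite switch_lin IH /= switch_cons_fun.
rewrite (row_finite_lin _ _ _ _ (row_finite_mulserl t)).
rewrite [X in _ = _ + (_ + X)](_ : _ = (-1) ^+ x.2 *
    mulser (fun v => (-1) ^+ sharp v * s (x :: v)) (switch b t) u); last first.
  rewrite /mulser mulr_sumr; apply: eq_bigr => p _.
  by rewrite /sharp /= exprD !mulrA.
by case: (x.2 == b); rewrite ?(mulser0l t u) expr0; ring.
Qed.

(** Cyclic forms are the fixed points of this rotation.  On words
    of length k its k-th power is the identity, and [csym] is the sum of its
    first k powers. *)
Definition turn a : series K (letter I) := fun nu =>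
  if nu is x :: u then swap [:: x] u * a (rcons u x) else a nu.

Lemma swap_signCat u v nu : swap nu (u ++ v) = swap nu u * swap nu v.
Proof. by rewrite swap_signC swap_sign_cat !(swap_signC nu). Qed.

Lemma iter_turn_cat a u v :
  iter (size u) turn a (u ++ v) = swap u v * a (v ++ u).
Proof.
elim/last_ind: u v a => [|u x IH] v a.
  by rewrite /= cats0 swap_signC swap_sign0 mul1r.
rewrite size_rcons iterSr cat_rcons IH /= -!cats1 swap_sign_cat -catA.
rewrite -[x :: v]cat1s !swap_signCat (swap_signC u [:: x]).
rewrite (_ : _ * _ * (_ * _ * _) = (swap [:: x] u * swap [:: x] u) *
  (swap u v * swap [:: x] v * a (v ++ (u ++ [:: x])))); last by ring.
by rewrite swap_signK mul1r.
Qed.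

Lemma iter_turn r a nu : (r <= size nu)%N ->
  iter r turn a nu = swap (take r nu) (drop r nu) * a (rot r nu).
Proof.
move=> ler; rewrite -iter_turn_cat cat_take_drop size_takel//.
Qed.

(** Rotating a word all the way around exchanges it with the empty word, hence
    without sign. *)
Lemma iter_turn_size a nu : iter (size nu) turn a nu = a nu.
Proof.
by rewrite iter_turn// drop_size take_size swap_sign0 mul1r rot_size.
Qed.

Lemma csymE a nu : csym deg a nu = \sum_(r < size nu) iter r turn a nu.
Proof. by apply: eq_bigr => r _; rewrite iter_turn// ltnW. Qed.

Lemma csym_turn a : csym deg (turn a) = csym deg a.
Proof.
apply: funext => nu; rewrite !csymE; under eq_bigr do rewrite -iterSr.
case E : (size nu) => [|n]; first by rewrite !big_ord0.
rewrite big_ord_recr big_ord_recl /= addrC; congr (_ + _).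
by have := iter_turn_size a nu; rewrite E.
Qed.

Lemma turn_csym a : turn (csym deg a) = csym deg a.
Proof.
apply: funext => -[|x u]; first by rewrite /turn /csym !big_ord0.
rewrite -[in RHS]csym_turn csymE /= csymE size_rcons mulr_sumr.
by apply: eq_bigr => r _; rewrite -iterSr.
Qed.

Lemma cyclic_csym a : cyclic_form deg (csym deg a).
Proof.
split=> [|x u]; first by rewrite /csym big_ord0.
by rewrite -[in LHS](turn_csym a).
Qed.

Lemma turn_cyclic a : cyclic_form deg a -> turn a = a.
Proof. by move=> [a0 Ha]; apply: funext => -[|x u] //=; rewrite Ha. Qed.

Lemma iter_turn_cyclic a r : cyclic_form deg a -> iter r turn a = a.
Proof. by move=> Ha; elim: r => //= r ->; rewrite turn_cyclic. Qed.

Lemma csym_cyclic a nu : cyclic_form deg a ->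
  csym deg a nu = (size nu)%:R * a nu.
Proof.
move=> Ha; rewrite csymE; under eq_bigr do rewrite iter_turn_cyclic//.
by rewrite sumr_const card_ord mulr_natl.
Qed.

Lemma swap_sign_letter (i : I) c u :
  swap [:: (i, c)] u = (-1) ^ (- deg i * ldeg deg u) * (-1) ^+ (c * sharp u).
Proof.
by rewrite /swap_sign /ldeg /= wdeg_cons /wdeg big_nil addr0 /sharp /= addn0.
Qed.

Lemma sign_sq n : (-1) ^+ n * (-1) ^+ n = 1 :> K.
Proof. by rewrite -exprMn mulrNN mulr1 expr1n. Qed.

(** The rotation moves the first letter x past the rest u with a sign that is
    bilinear in form degrees, so applying a derivation of odd form degree to
    either factor changes this sign exactly as the Koszul rule requires. *)
Lemma turn_switch b a : turn (switch b a) = switch b (turn a).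
Proof.
apply: funext => -[|[i c] u] //=; rewrite switch_rcons mulrDr addrC.
congr (_ + _) => /=.
  case: eqP => [->|]; last by rewrite !mulr0.
  rewrite !swap_sign_letter mulrA; congr (_ * _); rewrite -mulrA -exprD.
  by congr (_ * _); case: b; rewrite /= mul1n mul0n ?addn0// exprD sign_sq.
rewrite (@eq_switch b (fun v => turn a ((i, c) :: v))
  (fun v => (-1) ^+ c * swap [:: (i, c)] u * a (rcons v (i, c)))).
  by rewrite switchZ !mulrA sign_sq mul1r.
move=> v uv sv; rewrite /turn; congr (_ * _).
rewrite !swap_sign_letter /ldeg uv mulrCA -exprD; congr (_ * _).
case: c => /=; rewrite ?mul0n ?mul1n// ?addn0//.
move: sv; case: b => /=; rewrite ?addn0 addn1 => sv; last by rewrite sv.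
by rewrite -sv !exprS mulrA mulrNN !mul1r.
Qed.

Lemma switch_csym b a : switch b (csym deg a) = csym deg (switch b a).
Proof.
apply: funext => nu.
rewrite (@eq_switch b _ (fun u => \sum_(r < size nu) iter r turn a u)).
  rewrite switch_sum csymE; apply: eq_bigr => r _; congr (_ nu).
  by elim: (val r) => //= n <-; rewrite turn_switch.
move=> u /(congr1 size); rewrite !size_map => su _.
by rewrite csymE su.
Qed.

Lemma switch_cyclic b a : cyclic_form deg a -> cyclic_form deg (switch b a).
Proof.
move=> Ha; split=> // x u.
by rewrite -[in LHS](turn_cyclic Ha) -turn_switch.
Qed.

Definition ends_with_d nu := last false (map snd nu).

Lemma sum_last_rot (s : seq bool) :
  (\sum_(r < size s) last false (rot r s) = count id s)%N.
Proof.
case/lastP: s => [|s z]; first by rewrite big_ord0.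
rewrite size_rcons big_ord_recl rot0 last_rcons -cats1 count_cat /= addn0 addnC.
congr (_ + _)%N.
rewrite -sum1_count [RHS]big_mkcond [RHS](big_nth false) [RHS]big_mkord.
apply: eq_bigr => i _; rewrite /rot last_cat.
have -> : take (lift ord0 i) (s ++ [:: z]) = rcons (take i s) (nth false s i).
  by rewrite lift0 takel_cat// (take_nth false).
by rewrite last_rcons.
Qed.

(** Each differential of a cyclic word is brought to the end by exactly one
    rotation. *)
Lemma csym_ends_with_d a nu : cyclic_form deg a ->
  csym deg (fun u => if ends_with_d u then a u else 0) nu =
  (sharp nu)%:R * a nu.
Proof.
move=> Ha; rewrite /csym.
have -> : sharp nu = count id (map snd nu) by rewrite count_map.
rewrite -sum_last_rot size_map raddf_sum mulr_suml; apply: eq_bigr => r _.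
rewrite /ends_with_d map_rot.
case: (last _ _) => /=; last by rewrite mulr0 mul0r.
by rewrite -iter_turn 1?ltnW// iter_turn_cyclic// mul1r.
Qed.

Lemma csym_neq0 a nu : csym deg a nu != 0 -> exists r, a (rot r nu) != 0.
Proof.
move=> nz; apply: contrapT => /forallNP none; move: nz.
rewrite /csym big1 ?eqxx// => r _.
by rewrite [a _](_ : _ = 0) ?mulr0//; apply/eqP/negPn/negP/none.
Qed.

Lemma csym0 nu : csym deg (fun=> 0 : K) nu = 0.
Proof. by rewrite /csym big1// => r _; rewrite mulr0. Qed.

Lemma csymZ c s : csym deg (fun u => c * s u) = fun nu => c * csym deg s nu.
Proof.
apply: funext => nu; rewrite /csym mulr_sumr; apply: eq_bigr => r _.
by rewrite mulrCA.
Qed.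

Lemma csym_lin c s t :
  csym deg (fun u => c * s u + t u) =
  fun nu => c * csym deg s nu + csym deg t nu.
Proof.
apply: funext => nu; rewrite /csym mulr_sumr -big_split.
apply: eq_bigr => r _ /=.
by rewrite mulrDr mulrCA.
Qed.

Lemma eq_csym_size s t nu : (forall u, size u = size nu -> s u = t u) ->
  csym deg s nu = csym deg t nu.
Proof. by move=> st; apply: eq_bigr => r _; rewrite st ?size_rot. Qed.

End FormCalculus.

(** * Transformation of forms *)

Section Transform.
Variables (K : fieldType) (I : choiceType) (deg : I -> int).
Implicit Types (a s t w : series K (letter I)) (u v nu : seq (letter I)).
Implicit Types (x : letter I) (F : I -> series K I).

Lemma fun_series_neq0 (s : series K I) nu : fun_series s nu != 0 ->
  sharp nu = 0%N /\ s (map fst nu) != 0.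
Proof.
by rewrite /fun_series; case: (sharp nu =P 0%N) => // _; rewrite eqxx.
Qed.

Lemma form_image_neq0 F x nu : form_image F x nu != 0 ->
  sharp nu = x.2 /\ F x.1 (map fst nu) != 0.
Proof.
rewrite /form_image; case: x => i [] /=; last exact: fun_series_neq0.
rewrite dserE => /switch_neq0[u [unu su /fun_series_neq0[su0]]].
by rewrite unu => Fi; split=> //; move: su; rewrite su0 /= addn0.
Qed.

Lemma locally_finite_form_image F :
  locally_finite F -> locally_finite (form_image F).
Proof.
move=> [F0 Ffin]; split=> [x|nu].
  by apply/eqP/negPn/negP => /form_image_neq0[_]; rewrite F0 eqxx.
apply: (@sub_finite_set _ _ (
  (fun i => (i, true)) @` [set i | F i (map fst nu) != 0] `|`
  (fun i => (i, false)) @` [set i | F i (map fst nu) != 0])).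
  by case=> i [] /form_image_neq0[_ Fi]; [left|right]; exists i.
by rewrite finite_setU; split; apply: finite_image.
Qed.

Lemma locally_finite_formal_map F : formal_map deg F -> locally_finite F.
Proof. by case. Qed.

Lemma monosubst_form_image_neq0 F mu nu : formal_map deg F ->
  monosubst (form_image F) mu nu != 0 ->
  ldeg deg nu = ldeg deg mu /\ sharp nu = sharp mu.
Proof.
move=> [_ _ degF]; elim: mu nu => [|x mu IH] nu /=; first by move/mono_neq0->.
move=> /mulser_neq0[p _ [/form_image_neq0[sx Fx] /IH[dmu smu]]].
rewrite -(cat_take_drop p nu) ldeg_cat sharp_cat dmu sx smu; split=> //.
by rewrite [RHS]/ldeg /= wdeg_cons {1}/ldeg (degF _ _ Fx).
Qed.

Lemma subst_neq0 (A : choiceType) (B : eqType) (f : A -> series K B)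
    (b : series K A) (nu : seq B) :
  subst f b nu != 0 -> exists2 mu, b mu != 0 & monosubst f mu nu != 0.
Proof.
pose F (_ : unit) mu := b mu * monosubst f mu nu.
move=> /(@fsbigN1 _ _ _ _ _ _ F tt)[mu _].
by rewrite mulf_eq0 negb_or => /andP[? ?]; exists mu.
Qed.

Lemma row_finite_dser : row_finite (@dser K I).
Proof.
move=> nu; have [r Hr] := row_finite_switch K true nu.
by exists r => b; rewrite dserE.
Qed.

Lemma dser_mono0 nu : dser (mono K [::]) nu = 0 :> K.
Proof.
rewrite dserE; case: nu => [|[i c] u] //; rewrite switch_cons.
by rewrite [switch true _ u](switch0 K true u) mulr0 addr0; case: eqP.
Qed.

Lemma dser_mono1 x : dser (mono K [:: x]) =
  if x.2 then fun=> 0 else mono K [:: (x.1, true)].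
Proof.
apply: funext => nu; rewrite dserE; case: x => i b.
case: nu => [|[j c] u]; first by case: b.
rewrite switch_cons /=; have -> :
    switch true (fun v => mono K [:: (i, b)] ((j, c) :: v)) u = 0.
  case: u => [|y u] //; rewrite (@eq_switch _ _ true _ (fun=> 0)) ?switch0//.
  by move=> -[|z v] //= _ _; rewrite /mono eqseq_cons andbF.
rewrite mulr0 addr0 /mono !eqseq_cons.
by case: b; case: c; rewrite /= /mono ?eqseq_cons ?xpair_eqE ?andbF ?andbT.
Qed.

Lemma dser_mulser_homogeneous (n : nat) s t :
    (forall u, s u != 0 -> sharp u = n) ->
  dser (mulser s t) =
  fun nu => (-1) ^+ n * mulser s (dser t) nu + mulser (dser s) t nu.
Proof.
move=> sn; rewrite !dserE switch_mulser; apply: funext => nu.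
rewrite addrC; congr (_ + _); rewrite /mulser mulr_sumr; apply: eq_bigr => p _.
have [->|/sn ->] := eqVneq (s (take p nu)) 0.
  by rewrite mulr0 !mul0r mulr0.
by rewrite mulrA.
Qed.

(** Both sides are derivations along the substitution, and they agree on letters
    by the definition of the image of dphi^i and by d d = 0. *)
Lemma dser_subst F a : locally_finite F ->
  dser (subst (form_image F) a) = subst (form_image F) (dser a).
Proof.
move=> /locally_finite_form_image flf; have sf := row_finite_subst flf.
move: a; apply: row_finite_ext => [||mu].
- exact: (row_finite_comp row_finite_dser sf).
- exact: (row_finite_comp sf row_finite_dser).
rewrite subst_mono; elim: mu => [|x mu IH].
  rewrite /= (_ : dser (mono K [::]) = fun=> 0); last first.
    by apply: funext => nu; rewrite dser_mono0.
  by apply: funext => nu; rewrite (row_finite0 _ sf).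
have -> : monosubst (form_image F) (x :: mu) =
  mulser (form_image F x) (monosubst (form_image F) mu) by [].
rewrite (@dser_mulser_homogeneous x.2) => [|u /form_image_neq0[]//].
rewrite -cat1s -mulser_mono.
rewrite (@dser_mulser_homogeneous x.2) => [|u /mono_neq0->]; last first.
  by rewrite /sharp /= addn0.
apply: funext => nu; rewrite (row_finite_lin _ _ _ _ sf) !subst_mulser//.
rewrite subst_letter -IH subst_mono dser_mono1; congr (_ + mulser _ _ _).
case: x => i [] /=; last by rewrite subst_letter.
apply: funext => u; rewrite (row_finite0 _ sf).
exact: dser_dser.
Qed.

(** Substitution and cyclic symmetrization both commute with d and preserve the
    two degrees; the weights 1/k only depend on the length, which d preserves. *)
Lemma odd_two_form_transform F w : formal_map deg F -> odd_two_form deg w ->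
  odd_two_form deg (transform deg F w).
Proof.
move=> Fm [_ w2 wdeg cw]; have Flf := locally_finite_formal_map Fm.
have supp nu : transform deg F w nu != 0 -> exists2 mu, w mu != 0 &
    ldeg deg nu = ldeg deg mu /\ sharp nu = sharp mu.
  move=> /csym_neq0[r /subst_neq0[mu]].
  rewrite mulf_eq0 negb_or => /andP[wmu _] /(monosubst_form_image_neq0 Fm).
  by rewrite ldeg_rot sharp_rot; exists mu.
split; first exact: cyclic_csym.
- by move=> nu /supp[mu /w2 <- []].
- by move=> nu /supp[mu /wdeg <- []].
move=> nu; rewrite dserE switch_csym -dserE dser_subst//.
rewrite (_ : dser _ = fun=> 0).
  rewrite (_ : subst _ _ = fun=> 0) ?csym0//.
  apply: funext => u; apply: row_finite0.
  exact/row_finite_subst/locally_finite_form_image.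
apply: funext => u; rewrite dserE.
rewrite (@eq_switch _ _ true _ (fun v => (size u)%:R^-1 * w v)).
  by rewrite switchZ -dserE cw mulr0.
by move=> v /(congr1 size); rewrite !size_map mulrC => ->.
Qed.

End Transform.

(** * Formal maps and their inverses *)

Section FormalMaps.
Variables (K : fieldType) (I : choiceType) (deg : I -> int).
Implicit Types (F G H : I -> series K I) (J : seq I).

Definition id_map : I -> series K I := fun i => mono K [:: i].

Definition unipotent F := forall i J, (size J <= 1)%N -> F i J = id_map i J.

Lemma formal_map_id : formal_map deg id_map.
Proof.
have [id0 idfin] := @locally_finite_id K I; split=> // i J.
by move=> /mono_neq0 ->; rewrite wdeg_cons /wdeg big_nil addr0.
Qed.

Lemma formal_map_lin c F G : formal_map deg F -> formal_map deg G ->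
  formal_map deg (fun i J => c * F i J + G i J).
Proof.
move=> [F0 Ffin Fdeg] [G0 Gfin Gdeg].
have nz i J : c * F i J + G i J != 0 -> F i J != 0 \/ G i J != 0.
  have [->|] := eqVneq (F i J) 0; last by left.
  by rewrite mulr0 add0r; right.
split=> [i|J|i J /nz[/Fdeg|/Gdeg]//]; first by rewrite F0 G0 mulr0 addr0.
apply: (@sub_finite_set _ _ ([set i | F i J != 0] `|` [set i | G i J != 0])).
  by move=> i /nz.
by rewrite finite_setU.
Qed.

Lemma monosubst_wdeg F mu J : formal_map deg F ->
  monosubst F mu J != 0 -> wdeg deg J = wdeg deg mu.
Proof.
move=> [_ _ Fdeg]; elim: mu J => [|i mu IH] J /=; first by move/mono_neq0->.
move=> /mulser_neq0[p _ [/Fdeg di /IH dmu]].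
by rewrite -(cat_take_drop p J) wdeg_cat wdeg_cons di dmu.
Qed.

Lemma formal_map_subst F G : formal_map deg F -> formal_map deg G ->
  formal_map deg (fun i => subst F (G i)).
Proof.
move=> Fm Gm; have [FG0 FGfin] := locally_finite_subst
  (locally_finite_formal_map Fm) (locally_finite_formal_map Gm).
split=> // i J /subst_neq0[mu Gmu /(monosubst_wdeg Fm) ->].
by case: Gm => _ _; apply.
Qed.

Section StableLimit.
Variables (Fn : nat -> I -> series K I).
Hypothesis Fn_stable : forall n i J,
  (size J <= n.+1)%N -> Fn n.+1 i J = Fn n i J.

Definition stable_limit : I -> series K I := fun i J => Fn (size J) i J.

Lemma stable_limitE n i J : (size J <= n.+1)%N -> stable_limit i J = Fn n i J.
Proof.
move=> leJ; rewrite /stable_limit.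
have [le_nJ|/ltnW le_Jn] := leqP n (size J).
  have [->|lt_nJ] := eqVneq n (size J); first by [].
  by rewrite (_ : size J = n.+1) ?Fn_stable//; lia.
rewrite -(subnK le_Jn); elim: (n - size J)%N => //= k ->.
by rewrite addSn Fn_stable//; lia.
Qed.

Lemma formal_map_stable_limit :
  (forall n, formal_map deg (Fn n)) -> formal_map deg stable_limit.
Proof.
move=> Fm; split=> [i|J|i J]; first by have [F0 _ _] := Fm 0%N; exact: F0 i.
  by have [_ fin _] := Fm (size J); exact: fin J.
by have [_ _ wdegF] := Fm (size J); exact: wdegF i J.
Qed.

End StableLimit.

Section LeftInverse.
Variable F : I -> series K I.
Hypotheses (Fm : formal_map deg F) (Fu : unipotent F).

Let H : I -> series K I := fun i J => -1 * id_map i J + F i J.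

Lemma tail_size i J : H i J != 0 -> (2 <= size J)%N.
Proof.
rewrite ltnNge; apply: contra => le1.
by rewrite /H Fu// mulN1r addNr.
Qed.

(** Iteration for the fixed point equation G^i = phi^i - H^i(G).  As H starts in
    order 2, each pass fixes one more order. *)
Fixpoint inverse_approx n : I -> series K I :=
  if n is m.+1 then
    fun i J => -1 * subst (inverse_approx m) (H i) J + id_map i J
  else id_map.

Let G := inverse_approx.

Lemma formal_map_inverse_approx n : formal_map deg (G n).
Proof.
elim: n => [|n IH]; first exact: formal_map_id.
apply: formal_map_lin formal_map_id; apply: formal_map_subst IH _.
exact: formal_map_lin formal_map_id Fm.
Qed.

Lemma unipotent_inverse_approx n : unipotent (G n).
Proof.
case: n => [|n] i J le1 //=.
rewrite [subst _ _ _](_ : _ = 0) ?mulr0 ?add0r//.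
have [G0 _ _] := formal_map_inverse_approx n.
apply/eqP/negPn/negP => /subst_neq0[mu /tail_size ge2].
move=> /(monosubst_size G0) le_mu.
by have := leq_trans (leq_trans ge2 le_mu) le1.
Qed.

Lemma inverse_approx_stable n i J :
  (size J <= n.+1)%N -> G n.+1 i J = G n i J.
Proof.
have G0 m j : G m j [::] = 0 by have [] := formal_map_inverse_approx m.
elim: n i J => [|n IH] i J leJ; first by rewrite !unipotent_inverse_approx.
rewrite /G /= -!/(G _); congr (_ * _ + _).
apply: (eq_subst (m := n.+1) (k := 2)) => //.
- exact: G0 n.+1.
- exact: tail_size.
- by rewrite addn2.
Qed.

Lemma left_inverse_exists : exists G' : I -> series K I,
  [/\ formal_map deg G', unipotent G' & forall i, subst G' (F i) = id_map i].
Proof.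
pose L := stable_limit G.
have LE : forall n i J, (size J <= n.+1)%N -> L i J = G n i J.
  exact: stable_limitE inverse_approx_stable.
have Lm : formal_map deg L := formal_map_stable_limit formal_map_inverse_approx.
exists L; split=> // [i J le1|i]; first by rewrite (LE 0%N)//.
have -> : F i = fun J => 1 * id_map i J + H i J.
  by apply: funext => J; rewrite /H mul1r mulN1r addrA subrr add0r.
have Lfin := row_finite_subst (locally_finite_formal_map Lm).
apply: funext => J; rewrite (row_finite_lin _ _ _ _ Lfin) mul1r subst_letter.
rewrite (LE (size J).+1 i J (leqW (leqnSn _))).
rewrite (_ : subst L (H i) J = subst (G (size J)) (H i) J).
  by rewrite /= -/G mulN1r addrAC addNr add0r.
apply: (eq_subst (m := (size J).+1) (k := 2)).
- by have [] := Lm.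
- by have [] := formal_map_inverse_approx (size J).
- by move=> j u leu; exact: LE.
- exact: tail_size.
- by rewrite addn2; do 2 apply: leqW.
Qed.

End LeftInverse.

(** If G inverts F on the left and H inverts G on the left, then H = H G F = F by
    associativity of substitution, and so G is also a right inverse of F. *)
Lemma unipotent_coordinate_transformation F :
  formal_map deg F -> unipotent F -> coordinate_transformation deg F.
Proof.
move=> Fm Fu; split=> //.
have [G [Gm Gu GF]] := left_inverse_exists Fm Fu.
have [H [Hm _ HG]] := left_inverse_exists Gm Gu.
have FH i : H i = F i.
  have Hlf := locally_finite_formal_map Hm.
  have Glf := locally_finite_formal_map Gm.
  rewrite -[LHS]subst_letter -[mono _ _]GF subst_subst//.
  by rewrite (_ : (fun x => _) = id_map) ?subst_id//; apply: funext.
exists G; split=> // i J; first by rewrite GF.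
by rewrite (_ : F = H) ?HG//; apply: funext => j; rewrite FH.
Qed.

End FormalMaps.

(** * First variation of the transformed form *)

Section Variation.
Variables (K : numFieldType) (I : choiceType) (deg : I -> int).
Implicit Types (a s t w : series K (letter I)) (u v nu : seq (letter I)).
Implicit Types (x y : letter I) (F P : I -> series K I).

Lemma mulser_high_left (A : Type) (s t : series K A) n (u : seq A) (y : A) :
    (forall v : seq A, (size v < n)%N -> s v = 0) -> t [::] = 0 -> size u = n ->
  mulser s t (rcons u y) = s u * t [:: y].
Proof.
move=> s0 t0 un; rewrite /mulser size_rcons un.
have lt_n : (n < n.+2)%N by lia.
rewrite (bigD1 (Ordinal lt_n)) //= -cats1 take_size_cat// drop_size_cat//.
rewrite big1 ?addr0// => k; rewrite -val_eqE /= => kn.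
have [ltk|gek] := ltnP k n.
  by rewrite s0 ?mul0r// size_takel// size_cat /= un; lia.
rewrite drop_oversize ?t0 ?mulr0//.
by rewrite size_cat /= un; move/eqP: kn; lia.
Qed.

Lemma mulser_high_right (A : Type) (s t : series K A) n (u : seq A) (x : A) :
    s [::] = 0 -> (forall v : seq A, (size v < n)%N -> t v = 0) -> size u = n ->
  mulser s t (x :: u) = s [:: x] * t u.
Proof.
move=> s0 + un; case: n / un => t0; rewrite mulser_cons s0 mul0r add0r /mulser.
rewrite big_ord_recl take0 drop0 big1 ?addr0// => k _.
by rewrite [t _]t0 ?mulr0// size_drop lift0; have := ltn_ord k; lia.
Qed.

Lemma eq_form_image m F F' x u :
    (forall i J, (size J <= m)%N -> F i J = F' i J) -> (size u <= m)%N ->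
  form_image F x u = form_image F' x u.
Proof.
move=> FF um; have eq_fun v : size v = size u ->
    fun_series (F x.1) v = fun_series (F' x.1) v.
  by move=> vu; rewrite /fun_series FF// size_map vu.
rewrite /form_image; case: x.2; last exact: eq_fun.
rewrite !dserE; apply: eq_switch => v /(congr1 size); rewrite !size_map => vu _.
exact: eq_fun.
Qed.

(** Every other letter of a word of length at least 2 takes up at least one
    letter of the result. *)
Lemma eq_transform m F F' w nu :
    (forall i, F i [::] = 0) -> (forall i, F' i [::] = 0) ->
    (forall i J, (size J <= m)%N -> F i J = F' i J) ->
    (forall mu, w mu != 0 -> (2 <= size mu)%N) -> (size nu < m + 2)%N ->
  transform deg F w nu = transform deg F' w nu.
Proof.
have form_image_nil (G : I -> series K I) x :
    (forall i, G i [::] = 0) -> form_image G x [::] = 0.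
  by move=> G0; apply/eqP/negPn/negP => /form_image_neq0[_]; rewrite G0 eqxx.
move=> F0 F'0 FF w2 lt_nu; apply: eq_csym_size => u unu.
apply: (eq_subst (m := m) (k := 2)); rewrite ?unu//.
- by move=> x; apply: form_image_nil.
- by move=> x; apply: form_image_nil.
- by move=> x v; apply: eq_form_image.
- by move=> mu; rewrite mulf_eq0 negb_or => /andP[/w2].
Qed.

Lemma form_image_lin c P F x :
  form_image (fun i J => c * P i J + F i J) x =
  fun u => c * form_image P x u + form_image F x u.
Proof.
have eq_fun i : fun_series (fun J => c * P i J + F i J) =
    fun u => c * fun_series (P i) u + fun_series (F i) u.
  apply: funext => u; rewrite /fun_series.
  by case: ifP => // _; rewrite mulr0 addr0.
rewrite /form_image; case: x.2; rewrite eq_fun//.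
by rewrite !dserE switch_lin.
Qed.

Lemma form_image_id x : form_image (@id_map K I) x = mono K [:: x].
Proof.
have fun_id i : fun_series (mono K [:: i]) = mono K [:: (i, false)].
  apply: funext => -[|[j b] [|z u]] //; rewrite /fun_series /mono /=.
    by rewrite !eqseq_cons xpair_eqE !andbT; case: b; rewrite /= ?andbF ?andbT.
  by rewrite !eqseq_cons !andbF if_same.
rewrite /form_image /id_map; case: x => i [] /=; rewrite fun_id//.
exact: dser_mono1.
Qed.

(** On a word that ends with y this is the coefficient of sum_z w_zy dP^z, where z
    runs over the letters; for a 2-form only the differentials count.  The change
    of the second factor of w is then the rotation of this series. *)
Definition linear_variation P w : series K (letter I) := fun nu =>
  if nu is x :: u then
    \sum_(z \in [set: letter I])
      w [:: z; last x u] * form_image P z (belast x u)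
  else 0.

Lemma linear_variation_rcons P w u y : linear_variation P w (rcons u y) =
  \sum_(z \in [set: letter I]) w [:: z; y] * form_image P z u.
Proof. by case: u => [|x u] //=; rewrite last_rcons belast_rcons. Qed.

(** P preserves both degrees, so the sign of moving x past the word u substituted
    for z is the sign of exchanging x and z in w. *)
Lemma turn_linear_variation P w x u :
    formal_map deg P -> cyclic_form deg w ->
  turn deg (linear_variation P w) (x :: u) =
  \sum_(z \in [set: letter I]) w [:: x; z] * form_image P z u.
Proof.
move=> [_ _ Pdeg] [_ cw]; rewrite /turn linear_variation_rcons mulr_fsumr.
apply: eq_fsbigr => z _; rewrite mulrA.
have [->|/form_image_neq0[su Pu]] := eqVneq (form_image P z u) 0.
  by rewrite !mulr0.
rewrite cw /=; congr (_ * _ * _).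
rewrite /swap_sign su {1}/ldeg -[ldeg deg u]/(wdeg deg (map fst u)) (Pdeg _ _ Pu).
congr (_ ^ (_ * _) * _ ^+ (_ * _)); last by rewrite /sharp /= addn0.
by rewrite [RHS]/ldeg /= wdeg_cons /wdeg big_nil addr0.
Qed.

Lemma finite_functional_fsum_coef (T : choiceType) (A : eqType)
    (h : T -> seq A) (d : T -> K) : finite_set [set z | d z != 0] ->
  finite_functional (fun c : series K A => \sum_(z \in [set: T]) c (h z) * d z).
Proof.
move=> /finite_support_seq[r ur dr]; exists [seq (d z, h z) | z <- r] => c.
rewrite big_map (fsum_seq ur) => [|z].
  by apply: eq_bigr => z _; rewrite mulrC.
by rewrite mulf_eq0 negb_or => /andP[_ /dr].
Qed.

(** A word of length n+1 has no room for two pieces of which one has length at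
    least n and the other more than 1.  Hence P enters linearly, through the
    two-letter words only, and next to the first order of F, which is the
    identity. *)
Lemma subst_variation n P F x u u' y (c : series K (letter I)) :
    formal_map deg P -> formal_map deg F -> unipotent F ->
    (2 <= n)%N -> (forall i J, (size J < n)%N -> P i J = 0) ->
    (forall mu, c mu != 0 -> (2 <= size mu)%N) ->
    size u = n -> x :: u = rcons u' y ->
  subst (form_image (fun i J => 1 * P i J + F i J)) c (x :: u) =
    subst (form_image F) c (x :: u) +
    (\sum_(z \in [set: letter I]) c [:: z; y] * form_image P z u' +
     \sum_(z \in [set: letter I]) c [:: x; z] * form_image P z u).
Proof.
move=> Pm Fm Fu n2 P0 c2 un xuE; set F' := fun i J => 1 * P i J + F i J.
have F'm : formal_map deg F' by apply: formal_map_lin.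
have u'n : size u' = n.
  by have := congr1 size xuE; rewrite size_rcons /= un => -[].
have form_lf (G : I -> series K I) :
    formal_map deg G -> locally_finite (form_image G).
  by move=> /locally_finite_formal_map; apply: locally_finite_form_image.
have [flf f'lf plf] := And3 (form_lf _ Fm) (form_lf _ F'm) (form_lf _ Pm).
have p0 z v : (size v < n)%N -> form_image P z v = 0.
  move=> vn; apply/eqP/negPn/negP => /form_image_neq0[_].
  by rewrite P0 ?eqxx// size_map.
have f1 z y' : form_image F z [:: y'] = mono K [:: z] [:: y'].
  rewrite (@eq_form_image 1 _ (@id_map K I)) ?form_image_id//.
have f'E z v : form_image F' z v = 1 * form_image P z v + form_image F z v.
  by rewrite form_image_lin.
have f'1 z y' : form_image F' z [:: y'] = mono K [:: z] [:: y'].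
  by rewrite f'E p0 ?mulr0 ?add0r.
(* Both sides are finite functionals of c.  Restricting the argument to words of
   length at least 2 builds the hypothesis on c into them, so that monomials
   suffice. *)
pose restrict (b : series K (letter I)) : series K (letter I) :=
  fun mu => if (2 <= size mu)%N then b mu else 0.
have restrict_fin : row_finite restrict.
  move=> mu; rewrite /restrict; case: (1 < size mu)%N.
    exact: finite_functional_eval.
  exact: finite_functional0.
have cE : c = restrict c.
  apply: funext => mu; rewrite /restrict; case: ifPn => // mu2.
  by apply/eqP; apply: contraNT mu2; apply: c2.
rewrite cE; move: c {c2 cE}; apply: finite_functional_ext.
- exact: finite_functional_comp (row_finite_subst f'lf _) restrict_fin.
- apply: finite_functionalD.
    exact: finite_functional_comp (row_finite_subst flf _) restrict_fin.
  have fin (h : letter I -> seq (letter I)) v :=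
    finite_functional_fsum_coef h (plf.2 v).
  apply: finite_functionalD.
    exact: (finite_functional_comp (fin (fun z => [:: z; y]) u') restrict_fin).
  exact: (finite_functional_comp (fin (fun z => [:: x; z]) u) restrict_fin).
move=> mu; have [mu1|mu2] := leqP (size mu) 1.
  have -> : restrict (mono K mu) = fun=> 0.
    apply: funext => v; rewrite /restrict; case: ifP => // v2.
    by apply/eqP/negPn/negP => /mono_neq0 vmu; rewrite vmu ltnNge mu1 in v2.
  rewrite (row_finite0 _ (row_finite_subst f'lf)).
  rewrite (row_finite0 _ (row_finite_subst flf)).
  by rewrite !fsbig1 ?addr0// => z _; rewrite mul0r.
have -> : restrict (mono K mu) = mono K mu.
  apply: funext => v; rewrite /restrict; case: ifPn => // v2.
  by apply/esym/eqP; apply: contraNT v2 => /mono_neq0->.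
rewrite !subst_mono.
case: mu mu2 => [|p [|q [|r mu]]] // _; last first.
  rewrite !fsbig1 => [|z _|z _].
  - rewrite !addr0; apply: (eq_monosubst (m := n.-1)) => [z|z|z v vn|].
    + exact: f'lf.1.
    + exact: flf.1.
    + by rewrite f'E p0 ?mulr0 ?add0r// -(prednK (ltnW n2)).
    by rewrite /= un; lia.
  - by rewrite /mono !eqseq_cons /= !andbF mul0r.
  by rewrite /mono !eqseq_cons /= !andbF mul0r.
rewrite /= !mulser1r.
have fsum_single (z0 : letter I) (b : bool) (h : letter I -> seq (letter I)) d :
    (forall z, (h z == [:: p; q]) = (z == z0) && b) ->
    \sum_(z \in [set: letter I]) mono K [:: p; q] (h z) * d z = b%:R * d z0.
  move=> hE; rewrite (@fsum_seq _ _ [:: z0])// ?big_seq1.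
    by rewrite /mono hE eqxx.
  move=> z; rewrite mulf_eq0 negb_or inE => /andP[/mono_neq0 hz _].
  by move: (hE z); rewrite hz eqxx => /esym/andP[].
rewrite (fsum_single p (y == q)) => [|z]; last by rewrite !eqseq_cons andbT.
rewrite (fsum_single q (x == p)) => [|z]; last by rewrite !eqseq_cons andbT andbC.
have f'pE : form_image F' p = fun v => 1 * form_image P p v + form_image F p v.
  by apply: funext => v; rewrite f'E.
have f'qE : form_image F' q = fun v => 1 * form_image P q v + form_image F q v.
  by apply: funext => v; rewrite f'E.
rewrite {1}f'pE (row_finite_lin _ _ _ _ (row_finite_mulserl _)) mul1r.
rewrite [X in X + _ = _](_ : _ = (y == q)%:R * form_image P p u'); last first.
  rewrite xuE (mulser_high_left _ (p0 p) (f'lf.1 q) u'n) f'1 mulrC /mono.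
  by rewrite eqseq_cons andbT.
rewrite {1}f'qE (row_finite_lin _ _ _ _ (row_finite_mulserr _)) mul1r.
rewrite (mulser_high_right _ (flf.1 p) (p0 q) un) f1 /mono eqseq_cons andbT.
ring.
Qed.

End Variation.

(** * The Darboux theorem *)

Section Darboux.
Variables (K : numFieldType) (I : choiceType) (deg : I -> int).
Implicit Types (a s t w : series K (letter I)) (u v nu : seq (letter I)).
Implicit Types (x y : letter I) (F P : I -> series K I).

Definition primitive w : series K (letter I) :=
  fun nu => (size nu)%:R^-1 * switch false w nu.

Lemma switch_size_scale b (h : nat -> K) w nu :
  switch b (fun u => h (size u) * w u) nu = h (size nu) * switch b w nu.
Proof.
rewrite (@eq_switch _ _ b _ (fun u => h (size nu) * w u)) ?switchZ//.
by move=> u /(congr1 size); rewrite !size_map => ->.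
Qed.

Lemma primitive_cyclic w : cyclic_form deg w -> cyclic_form deg (primitive w).
Proof.
move=> /(switch_cyclic false)[_ cw]; split=> [|x u].
  by rewrite /primitive mulr0.
by rewrite /primitive cw size_rcons mulrCA.
Qed.

Lemma primitive_neq0 w nu : odd_two_form deg w -> primitive w nu != 0 ->
  sharp nu = 1%N /\ ldeg deg nu = -1.
Proof.
move=> [_ w2 wdeg1 _]; rewrite /primitive mulf_eq0 negb_or => /andP[_].
move=> /switch_neq0[u [unu su wu]].
split; last by rewrite -(wdeg1 _ wu) /ldeg unu.
by move: su; rewrite (w2 _ wu) addn0 addn1 => -[].
Qed.

(** Poincare lemma: contraction, divided by the length, is a homotopy from the
    identity to zero. *)
Lemma dser_primitive w : odd_two_form deg w -> dser (primitive w) = w.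
Proof.
move=> [[w0 _] _ _ cw]; apply: funext => -[|x u].
  by rewrite dserE w0.
rewrite dserE (switch_size_scale true (fun n => n%:R^-1)).
have := switch_homotopy w (x :: u).
rewrite -[switch true w]dserE (_ : dser w = fun=> 0); last exact: funext.
by rewrite switch0 addr0 => ->; rewrite mulKf// pnatr_eq0.
Qed.

Lemma sharp0_phis u : sharp u = 0%N -> phis (map fst u) = u.
Proof. by elim: u => [|[i []] u IH] //= su; rewrite IH. Qed.

(** The coefficient theta_j of dphi^j in the primitive theta, as a series in the
    coordinates. *)
Definition potential w (j : I) : series K I :=
  fun J => primitive w (rcons (phis J) (j, true)).

Lemma potential_deg w j J : odd_two_form deg w -> potential w j J != 0 ->
  deg j = wdeg deg J + 1.
Proof.
move=> hw /(primitive_neq0 hw)[_]; rewrite -cats1 ldeg_cat /ldeg /=.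
rewrite -map_comp map_id wdeg_cons /wdeg big_nil addr0 => /eqP.
rewrite subr_eq => /eqP ->; ring.
Qed.

(** The sum of theta_j dphi^j before cyclic symmetrization. *)
Definition primitive_tail w : series K (letter I) :=
  fun nu => if ends_with_d nu then primitive w nu else 0.

Lemma dser_primitive_tail w u i b : odd_two_form deg w ->
  dser (primitive_tail w) (rcons u (i, b)) =
  if b then dser (fun_series (potential w i)) u else 0.
Proof.
move=> hw; rewrite !dserE switch_rcons.
have tailE v c : primitive_tail w (rcons v (i, c)) =
    if c then primitive w (rcons v (i, c)) else 0.
  by rewrite /primitive_tail /ends_with_d map_rcons last_rcons.
rewrite tailE if_same mulr0 addr0.
rewrite (_ : (fun v => _) = if b then fun_series (potential w i) else fun=> 0).
  by case: b; rewrite ?switch0.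
apply: funext => v; rewrite tailE; case: b => //.
rewrite /fun_series; case: eqP => [/sharp0_phis sv|sv].
  by rewrite /potential sv.
apply/eqP/negPn/negP => /(primitive_neq0 hw)[+ _].
by rewrite -cats1 sharp_cat addn1 => -[].
Qed.

(** d commutes with cyclic symmetrization, and theta, having form degree 1, is the
    symmetrization of its tail. *)
Lemma csym_dser_primitive_tail w nu : odd_two_form deg w ->
  csym deg (dser (primitive_tail w)) nu = w nu.
Proof.
move=> hw; have [cw _ _ _] := hw.
rewrite dserE -switch_csym (_ : csym deg (primitive_tail w) = primitive w).
  by rewrite -dserE dser_primitive.
apply: funext => u; rewrite csym_ends_with_d; last exact: primitive_cyclic.
have [->|/(primitive_neq0 hw)[-> _]] := eqVneq (primitive w u) 0.
  by rewrite mulr0.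
by rewrite mul1r.
Qed.

(** The last clause makes corrections vanish wherever the transformed form already
    does; this is what makes the iteration stabilize. *)
Definition solves (g : I -> I -> K) (n : int) (c v : I -> K) :=
  [/\ finite_set [set i | v i != 0],
      forall i, v i != 0 -> deg i = 1 - n,
      forall j, \sum_(i \in [set: I]) v i * g i j = c j
    & (forall j, c j = 0) -> forall i, v i = 0].

(** As g pairs degree m with degree 1 - m only, the part of a solution in degree
    1 - n is still a solution. *)
Lemma solver_exists g :
    (forall i j, g i j != 0 -> deg i + deg j = 1) ->
    nondegenerate_pairing deg g ->
  exists S : int * (I -> K) -> I -> K,
    forall n c, (forall j, c j != 0 -> deg j = n) -> solves g n c (S (n, c)).
Proof.
move=> gdeg gnd.
suff /choice[S HS] : forall nc : int * (I -> K), exists v : I -> K,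
    (forall j, nc.2 j != 0 -> deg j = nc.1) -> solves g nc.1 nc.2 v.
  by exists S => n c; apply: (HS (n, c)).
move=> [n c] /=.
have [cn|ncn] := pselect (forall j, c j != 0 -> deg j = n); last first.
  by exists (fun=> 0).
have [c0|nc0] := pselect (forall j, c j = 0).
  exists (fun=> 0) => _; split=> //.
  - by rewrite (_ : mkset _ = set0)// -subset0 => i /=; rewrite eqxx.
  - by move=> i; rewrite eqxx.
  - by move=> j; rewrite fsbig1 ?c0// => i _; rewrite mul0r.
have [v [[vfin vE] _]] := gnd n c cn.
pose v' i := if deg i == 1 - n then v i else 0.
have v'neq0 i : v' i != 0 -> v i != 0 /\ deg i = 1 - n.
  by rewrite /v'; case: (deg i =P 1 - n) => // _; rewrite eqxx.
exists v' => _; split; last by move/nc0.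
- by apply: sub_finite_set vfin => i /= /v'neq0[].
- by move=> i /v'neq0[].
move=> j; have [jn|jn] := eqVneq (deg j) n.
  rewrite -vE; apply: eq_fsbigr => i _; rewrite /v'; case: eqP => // ni.
  have [->|/gdeg gij] := eqVneq (g i j) 0; first by rewrite !mulr0.
  by case: ni; rewrite -gij jn addrK.
have -> : c j = 0 by apply/eqP; apply: contraNT jn => /cn ->.
rewrite fsbig1// => i _.
have [->|/v'neq0[_ di]] := eqVneq (v' i) 0; first by rewrite mul0r.
have [->|/gdeg] := eqVneq (g i j) 0; first by rewrite mulr0.
by move=> /eqP; rewrite di -subr_eq0 => /eqP dj; case/eqP: jn; lia.
Qed.

Section Iteration.
Variables (w : series K (letter I)) (om : two_coefs K I).
Variable S : int * (I -> K) -> I -> K.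
Hypothesis hw : odd_two_form deg w.
Let g i j := om i j [::] [::].
Hypothesis w_quadratic : forall i j, w [:: (i, true); (j, true)] = 2 * g i j.
Hypothesis HS : forall n c,
  (forall j, c j != 0 -> deg j = n) -> solves g n c (S (n, c)).

Lemma two_form_size mu : w mu != 0 -> (2 <= size mu)%N.
Proof. by have [_ w2 _ _] := hw; move=> /w2 <-; apply: count_size. Qed.

(** Solves sum_i 2 g_ij P^i = - theta_j in all orders from 2 on.  Only the lowest
    order in which w' is nonzero matters for the induction; the higher ones are
    changed again by the following steps. *)
Definition correction w' : I -> series K I := fun i J =>
  if (2 <= size J)%N then
    S (wdeg deg J + 1, fun j => - 2^-1 * potential w' j J) i
  else 0.

Definition improve F : I -> series K I :=
  fun i J => 1 * correction (transform deg F w) i J + F i J.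

Lemma correction_solves w' J : odd_two_form deg w' ->
  solves g (wdeg deg J + 1) (fun j => - 2^-1 * potential w' j J)
    (S (wdeg deg J + 1, fun j => - 2^-1 * potential w' j J)).
Proof.
move=> hw'; apply: HS => j; rewrite mulf_eq0 negb_or => /andP[_].
exact: potential_deg.
Qed.

Lemma formal_map_correction w' :
  odd_two_form deg w' -> formal_map deg (correction w').
Proof.
move=> hw'; split=> // [J|i J].
  have [fin _ _ _] := correction_solves J hw'.
  apply: sub_finite_set fin => i /=.
  by rewrite /correction; case: ifP => //; rewrite eqxx.
rewrite /correction; case: ifP => [_|]; last by rewrite eqxx.
have [_ degS _ _] := correction_solves J hw'.
by move=> /degS ->; rewrite opprB [X in X - _]addrC; ring.
Qed.

Lemma correction_low n w' : (forall nu, (3 <= size nu <= n)%N -> w' nu = 0) ->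
  odd_two_form deg w' ->
  forall i J, (size J < n)%N -> correction w' i J = 0.
Proof.
move=> w'0 hw' i J Jn; rewrite /correction; case: ifP => // J2.
have [_ _ _] := correction_solves J hw'; apply => j.
rewrite /potential /primitive (@eq_switch _ _ false _ (fun=> 0)).
  by rewrite switch0 !mulr0.
move=> u /(congr1 size); rewrite !size_map size_rcons size_map => su _.
by apply: w'0; rewrite su; lia.
Qed.

(** The linear variation caused by the correction is minus the derivative of
    sum_j theta_j dphi^j, already before cyclic symmetrization. *)
Lemma linear_variation_correction w' u y : odd_two_form deg w' ->
    (2 <= size u)%N ->
  linear_variation (correction w') w (rcons u y) =
  - dser (primitive_tail w') (rcons u y).
Proof.
move=> hw' u2; have [_ w2 _ _] := hw.
rewrite linear_variation_rcons; case: y => j b; rewrite dser_primitive_tail//.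
case: b; last first.
  rewrite fsbig1 ?oppr0// => -[i c] _.
  rewrite [w _](_ : _ = 0) ?mul0r//; apply/eqP/negPn/negP => /w2/eqP.
  by case: c.
have -> : \sum_(z \in [set: letter I])
    w [:: z; (j, true)] * form_image (correction w') z u =
  \sum_(i \in [set: I])
    dser (fun v => 2 * g i j * fun_series (correction w' i) v) u.
  rewrite -(@fsbig_widen _ _ _ _ (range (fun i : I => (i, true)))) //=; last first.
    move=> [i [|]] [_ /= ni]; first by case: ni; exists i.
    by rewrite [w _](_ : _ = 0) ?mul0r//; apply/eqP/negPn/negP => /w2/eqP.
  rewrite fsbig_image; last by move=> i1 i2 _ _ [].
  apply: eq_fsbigr => i _.
  by rewrite w_quadratic /form_image /= !dserE switchZ.
have corr_fin := formal_map_correction hw'.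
have fin v :
    finite_set [set i | 2 * g i j * fun_series (correction w' i) v != 0].
  have [_ cfin _] := corr_fin.
  apply: sub_finite_set (cfin (map fst v)) => i /=.
  by rewrite mulf_eq0 negb_or => /andP[_ /fun_series_neq0[]].
rewrite -(finite_functional_fsum (@row_finite_dser K I u) fin).
rewrite -mulN1r !dserE.
rewrite (@eq_switch _ _ true _ (fun v => -1 * fun_series (potential w' j) v)).
  by rewrite switchZ.
move=> v /(congr1 size); rewrite !size_map => vu _.
rewrite /fun_series; case: ifP => _; last first.
  by rewrite mulr0 fsbig1// => i _; rewrite mulr0.
rewrite /correction size_map vu u2.
have [_ _ + _] := correction_solves (map fst v) hw' => /(_ j) Sj.
under eq_fsbigr do rewrite -mulrA [g _ _ * _]mulrC.
by rewrite -mulr_fsumr Sj mulrA mulrN mulfV ?pnatr_eq0.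
Qed.

Section Step.
Variables (F : I -> series K I) (n : nat).
Hypotheses (Fm : formal_map deg F) (Fu : unipotent F) (n2 : (2 <= n)%N).
Hypothesis F0 : forall nu, (3 <= size nu <= n)%N -> transform deg F w nu = 0.

Let w' := transform deg F w.

Lemma transform_odd : odd_two_form deg w'.
Proof. exact: odd_two_form_transform. Qed.

Lemma formal_map_improve : formal_map deg (improve F).
Proof. exact/formal_map_lin/Fm/formal_map_correction/transform_odd. Qed.

Lemma improve_low i J : (size J < n)%N -> improve F i J = F i J.
Proof.
move=> Jn; rewrite /improve (correction_low F0 transform_odd) ?mulr0 ?add0r//.
Qed.

Lemma unipotent_improve : unipotent (improve F).
Proof. by move=> i J J1; rewrite improve_low ?Fu//; lia. Qed.

(** Up to length n nothing changes.  In length n+1 the variation is half of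
    Y + T Y, where T is the rotation and Y the linear variation.  Its cyclic
    symmetrization is that of Y, namely -w'. *)
Lemma transform_improve nu :
  (3 <= size nu <= n.+1)%N -> transform deg (improve F) w nu = 0.
Proof.
move=> /andP[nu3 nun]; have [lt_nu|gt_nu] := leqP (size nu) n.
  rewrite (@eq_transform _ _ _ n.-1 (improve F) F) ?F0 ?nu3//.
  - by have [] := formal_map_improve.
  - by have [] := Fm.
  - by move=> i J Jn; rewrite improve_low//; lia.
  - exact: two_form_size.
  - lia.
have {gt_nu nun}nun : size nu = n.+1 by lia.
have [cw _ _ _] := hw.
pose Y := linear_variation (correction w') w.
pose c mu := w mu / (size mu)%:R.
have corr_m := formal_map_correction transform_odd.
have variation u : size u = n.+1 ->
    subst (form_image (improve F)) c u =
    2^-1 * (Y u + turn deg Y u) + subst (form_image F) c u.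
  case/lastP: u => // u y uyn; case E : (rcons u y) => [|x u'].
    by move: (congr1 size E); rewrite size_rcons.
  have u'n : size u' = n by move: uyn; rewrite E => -[].
  rewrite (@subst_variation _ _ deg n (correction w') F x u' u y) => //.
  - rewrite addrC; congr (_ + _); rewrite mulrDr.
    rewrite turn_linear_variation// -E /Y linear_variation_rcons !mulr_fsumr.
    by congr (_ + _); apply: eq_fsbigr => z _; rewrite /c /= mulrA [2^-1 * _]mulrC.
  - exact: correction_low F0 transform_odd.
  by move=> mu; rewrite mulf_eq0 negb_or => /andP[/two_form_size].
rewrite /transform -/c (eq_csym_size deg (t := fun u =>
  2^-1 * (Y u + turn deg Y u) + subst (form_image F) c u)); last first.
  by move=> u; rewrite nun; apply: variation.
rewrite csym_lin -[csym deg (subst _ _) nu]/(w' nu).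
rewrite (_ : (fun u => Y u + _) = fun u => 1 * Y u + turn deg Y u); last first.
  by apply: funext => u; rewrite mul1r.
rewrite csym_lin csym_turn mul1r.
have -> : csym deg Y nu = - w' nu.
  rewrite (eq_csym_size deg (t := fun u => -1 * dser (primitive_tail w') u)).
    by rewrite csymZ csym_dser_primitive_tail ?mulN1r//; apply: transform_odd.
  move=> u; rewrite nun; case/lastP: u => // u y uyn; rewrite mulN1r.
  apply: linear_variation_correction; first exact: transform_odd.
  by move: uyn; rewrite size_rcons => -[->].
by field.
Qed.

End Step.

(** The approximation number k is exact on words of length at most k+1, and its
    transform has no terms of length 3 to k+2. *)
Fixpoint darboux_approx k : I -> series K I :=
  if k is m.+1 then improve (darboux_approx m) else @id_map K I.

Lemma transform_id : transform deg (@id_map K I) w = w.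
Proof.
have [cw _ _ _] := hw; apply: funext => nu.
rewrite /transform (_ : form_image (@id_map K I) = fun x => mono K [:: x]); last first.
  by apply: funext => x; rewrite form_image_id.
rewrite subst_id (eq_csym_size deg (t := fun u => (size nu)%:R^-1 * w u)); last first.
  by move=> u ->; rewrite mulrC.
rewrite csymZ csym_cyclic//; case: nu => [|x u].
  by case: cw => ->; rewrite !mulr0.
by rewrite mulKf ?pnatr_eq0.
Qed.

Lemma darboux_approx_spec k (F := darboux_approx k) :
  [/\ formal_map deg F, unipotent F &
    forall nu, (3 <= size nu <= k.+2)%N -> transform deg F w nu = 0].
Proof.
rewrite /F {F}; elim: k => [|k [km ku k0]] /=.
  split=> // [|nu]; first exact: formal_map_id.
  by case: (size nu) => [|[|[|[]]]].
split; [exact: formal_map_improve | exact: (unipotent_improve (n := k.+2)) | ].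
exact: transform_improve.
Qed.

Lemma darboux_approx_stable k i J :
  (size J <= k.+1)%N -> darboux_approx k.+1 i J = darboux_approx k i J.
Proof.
move=> Jk; have [km ku k0] := darboux_approx_spec k.
exact: (improve_low (n := k.+2)).
Qed.

Lemma darboux_map : exists F, [/\ formal_map deg F, unipotent F &
  forall nu, (3 <= size nu)%N -> transform deg F w nu = 0].
Proof.
pose F := stable_limit darboux_approx.
have FE : forall n i J, (size J <= n.+1)%N -> F i J = darboux_approx n i J.
  exact: stable_limitE darboux_approx_stable.
have Fm : formal_map deg F.
  by apply: formal_map_stable_limit => k; have [] := darboux_approx_spec k.
exists F; split=> // [i J J1|nu nu3]; first by rewrite (FE 0%N).
have [km ku k0] := darboux_approx_spec (size nu).
rewrite (@eq_transform _ _ _ (size nu).+1 F (darboux_approx (size nu))).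
- by apply: k0; rewrite nu3 /=; do 2 apply: leqW.
- by have [] := Fm.
- by have [] := km.
- by move=> i J; apply: FE.
- exact: two_form_size.
- by rewrite addn2; do 2 apply: leqW.
Qed.

End Iteration.

Definition constant_part (om : two_coefs K I) : two_coefs K I :=
  fun i j J L => if (J == [::]) && (L == [::]) then om i j J L else 0.

(** One of n and 1 - n is even. *)
Lemma sign_mul_pred (n : int) : (-1 : K) ^ (n * (1 - n)) = 1.
Proof.
have N1 : (-1 : K) != 0 by rewrite oppr_eq0 oner_eq0.
rewrite -exprz_exp; have : ((-1 : K) ^ n) ^+ 2 == 1.
  by rewrite exprnP exprz_exp mulrC -exprz_exp -exprnP sqrrN expr1n exp1rz.
rewrite sqrf_eq1 => /orP[/eqP -> | /eqP nE]; first by rewrite exp1rz.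
by rewrite nE expfzDr// -invr_expz nE expr1z invrN1 mulrNN mulr1.
Qed.

Lemma fsumD (T : choiceType) (f g : T -> K) :
    finite_set [set x | f x != 0] -> finite_set [set x | g x != 0] ->
  \sum_(x \in [set: T]) (f x + g x) =
  \sum_(x \in [set: T]) f x + \sum_(x \in [set: T]) g x.
Proof.
move=> /finite_support_seq[r _ fr] /finite_support_seq[q _ gq].
have ur : uniq (undup (r ++ q)) by exact: undup_uniq.
rewrite !(fsum_seq ur) ?big_split// => x; rewrite mem_undup mem_cat.
- by move/gq ->; rewrite orbT.
- by move/fr ->.
by have [->|/fr ->//] := eqVneq (f x) 0; rewrite add0r => /gq ->; rewrite orbT.
Qed.

(** Two words contribute to this coefficient, with coefficients om_ij and om_ji.
    If these are nonzero, the degrees of i and j add up to 1, so that exchanging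
    the two differentials gives the sign -1 and the antisymmetric pair adds up. *)
Lemma two_form_pair (om : two_coefs K I) w i j : symplectic_coefs deg om w ->
  w [:: (i, true); (j, true)] = 2 * om i j [::] [::].
Proof.
move=> [-> anti odeg _]; rewrite /two_form.
pose t0 (i j : I) : (I * I) * (seq I * seq I) := ((i, j), ([::], [::])).
have word_eq (t : (I * I) * (seq I * seq I)) i' j' : [:: (i', true); (j', true)] =
    two_word t.1.1 t.1.2 t.2.1 t.2.2 -> t = t0 i' j'.
  by case: t => [[a b] [[|? J] [|? L]]] //= [-> ->].
pose f (c : K) i' j' (t : (I * I) * (seq I * seq I)) :=
  om t.1.1 t.1.2 t.2.1 t.2.2 * (c *
      mono K (two_word t.1.1 t.1.2 t.2.1 t.2.2) [:: (i', true); (j', true)]).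
have f_neq0 c i' j' p : f c i' j' p != 0 -> p = t0 i' j'.
  by rewrite /f !mulf_eq0 !negb_or => /and3P[_ _ /mono_neq0/word_eq ->].
have ffin c i' j' : finite_set [set t | f c i' j' t != 0].
  by apply: (@sub_finite_set _ _ [set t0 i' j']) => // t /f_neq0.
have single c i' j' : \sum_(t \in [set: (I * I) * (seq I * seq I)]) f c i' j' t =
    om i' j' [::] [::] * c.
  rewrite (@fsum_seq _ _ [:: t0 i' j'])// => [|t /f_neq0 ->]; last exact: mem_head.
  by rewrite big_seq1 /f /= /mono eqxx mulr1.
pose s := swap_sign K deg [:: (i, true)] [:: (j, true)].
transitivity (om i j [::] [::] * 1 + om j i [::] [::] * s).
  rewrite -!single -fsumD//; apply: eq_fsbigr => t _.
  rewrite /f -mulrDr; congr (_ * _).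
  rewrite csymE !big_ord_recl big_ord0 addr0 /= mul1r.
  by [].
rewrite mulr1 (anti j i); have [->|/odeg] := eqVneq (om i j [::] [::]) 0.
  by rewrite oppr0 mul0r addr0 mulr0.
move=> degij; have -> : s = -1; last by ring.
rewrite /s swap_sign_letter expr1.
have -> : - deg i * ldeg deg [:: (j, true)] = deg i * (1 - deg i).
  move: degij; rewrite /ldeg /= !wdeg_cons /wdeg big_nil !addr0 => dij.
  rewrite [in RHS](_ : 1 - deg i = deg j); last by lia.
  ring.
by rewrite sign_mul_pred mul1r.
Qed.

Lemma two_form_constant (om : two_coefs K I) w w' :
    symplectic_coefs deg om w -> has_form_degree 2 w' ->
    (forall nu, (3 <= size nu)%N -> w' nu = 0) ->
    (forall nu, (size nu <= 2)%N -> w' nu = w nu) ->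
  symplectic_coefs deg (constant_part om) w'.
Proof.
move=> [wE anti odeg nondeg] w'2 w'3 w'w; split=> // [nu|i j J L|i j J L].
- have csym_size u : size u != size nu -> csym deg (mono K u) nu = 0.
    move=> ne; apply/eqP/negPn/negP => /csym_neq0[r /mono_neq0 unu].
    by rewrite -unu size_rot eqxx in ne.
  have [nu2|nu2] := eqVneq (size nu) 2.
    rewrite w'w ?nu2// wE; apply: eq_fsbigr => -[[i j] [J L]] _ /=.
    rewrite /constant_part; case: ifPn => // JL; rewrite mul0r csym_size ?mulr0//.
    rewrite nu2 /two_word /= size_cat /= !size_map addnS.
    by case: J L JL => [|? ?] [|? ?] //=; rewrite addnS.
  rewrite /two_form fsbig1 => [|[[i j] [J L]] _ /=]; last first.
    rewrite /constant_part; case: ifP => [/andP[/eqP-> /eqP->]|_].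
      by rewrite csym_size ?mulr0// eq_sym.
    by rewrite mul0r.
  have [nu3|] := leqP 3 (size nu); first exact: w'3.
  rewrite ltnS leq_eqVlt (negPf nu2) /= => nu1.
  apply/eqP/negPn/negP => /w'2 nuE.
  by have := count_size snd nu; rewrite -/(sharp nu) nuE leqNgt nu1.
- by rewrite /constant_part andbC; case: ifP => _; rewrite ?oppr0.
- by rewrite /constant_part; case: ifP => _; rewrite ?eqxx//; apply: odeg.
Qed.

Theorem darboux w : odd_symplectic deg w ->
  exists F : I -> series K I,
    coordinate_transformation deg F /\
    constant_odd_symplectic deg (transform deg F w).
Proof.
move=> [hw [om hom]]; have [_ _ odeg nondeg] := hom.
have gdeg i j : om i j [::] [::] != 0 -> deg i + deg j = 1.
  move=> /odeg; rewrite /ldeg /= !wdeg_cons /wdeg big_nil addr0; lia.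
have [S HS] := solver_exists gdeg nondeg.
have [F [Fm Fu F3]] := darboux_map hw (fun i j => two_form_pair i j hom) HS.
have hw' : odd_two_form deg (transform deg F w) by apply: odd_two_form_transform.
exists F; split; first exact: unipotent_coordinate_transformation.
split=> //; exists (constant_part om); split; last first.
  move=> i j J L JL; rewrite /constant_part; case: ifP => // /andP[/eqP J0 /eqP L0].
  by case: JL; rewrite J0 L0.
apply: (two_form_constant hom) => // [|nu nu2]; first by case: hw'.
rewrite -[in RHS](transform_id hw).
apply: (eq_transform deg (m := 1)) => //.
- by have [] := Fm.
- exact: two_form_size hw.
Qed.

End Darboux.

Theorem theorem4p15 (R : realType) (I : choiceType) (deg : I -> int)
    (w : series R[i] (letter I)) (hw : odd_symplectic deg w) :
  exists F : I -> series R[i] I,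
    coordinate_transformation deg F /\
    constant_odd_symplectic deg (transform deg F w).
Proof. exact: (@darboux R[i] I deg w hw). Qed.
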